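(* Let $n=1$ and let $f_1,f_2:\Omega\times[0,T]\times\mathbb{R}\times\mathbb{R}^d\times\mathbb{R}\times\mathbb{R}^d\to\mathbb{R}$ be two standard Lipschitz drivers (in the sense of the context), with $f_2$ independent of $(z,z')$, so that $f_2=f_2(t,y,y')$. Let $\xi^i\in L^2(\mathcal{F}_T)$, $K^i\in\mathcal{S}^2$, and let $(Y^i,Z^i)\in\mathcal{S}^2\times\mathcal{H}^2_d$, $i=1,2$, be the solution to $$Y^i_t=\xi^i+\int_t^T f_i(s,Y^i_s,Z^i_s,\mathsf{E}[Y^i_s|\mathcal{G}_s],\mathsf{E}[Z^i_s|\mathcal{G}_s])\,ds-\int_t^T Z^i_s\,dB_s+K^i_T-K^i_t,\quad t\in[0,T].$$ Suppose that (1) $\mathsf{E}[\xi^1|\mathcal{G}_T]\le\mathsf{E}[\xi^2|\mathcal{G}_T]$; (2) $\{\mathsf{E}[K^2_t-K^1_t|\mathcal{G}_t]\}_{t\in[0,T]}$ (or $\{K^2_t-K^1_t\}_{t\in[0,T]}$) is a nondecreasing process; (3) for any $t\in[0,T]$, $$\mathsf{E}\big[f_1(t,Y^1_t,Z^1_t,\mathsf{E}[Y^1_t|\mathcal{G}_t],\mathsf{E}[Z^1_t|\mathcal{G}_t])\big|\mathcal{G}_t\big]\le\mathsf{E}\big[f_2(t,Y^1_t,\mathsf{E}[Y^1_t|\mathcal{G}_t])\big|\mathcal{G}_t\big];$$ (4) the process $\{a_t\}_{t\in[0,T]}$ is $\mathbb{G}$-adapted and $a_t+b_t\ge0$ for any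 $t\in[0,T]$, where $$a_t=\frac{f_2(t,Y^1_t,\mathsf{E}[Y^1_t|\mathcal{G}_t])-f_2(t,Y^2_t,\mathsf{E}[Y^1_t|\mathcal{G}_t])}{Y^1_t-Y^2_t}\,I_{\{Y^1_t\ne Y^2_t\}},$$ $$b_t=\frac{f_2(t,Y^2_t,\mathsf{E}[Y^1_t|\mathcal{G}_t])-f_2(t,Y^2_t,\mathsf{E}[Y^2_t|\mathcal{G}_t])}{\mathsf{E}[Y^1_t|\mathcal{G}_t]-\mathsf{E}[Y^2_t|\mathcal{G}_t]}\,I_{\{\mathsf{E}[Y^1_t|\mathcal{G}_t]\ne\mathsf{E}[Y^2_t|\mathcal{G}_t]\}}.$$ Then $\mathsf{E}[Y^1_t|\mathcal{G}_t]\le\mathsf{E}[Y^2_t|\mathcal{G}_t]$, for all $t\in[0,T]$, $\mathsf{P}$-a.s.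
   Context: Fix $T>0$. $(\Omega,\mathcal{F},\mathbb{F},\mathsf{P})$ is a filtered probability space with $\mathbb{F}=\{\mathcal{F}_t\}_{t\in[0,T]}$ satisfying the usual conditions of right-continuity and completeness, and $B$ is a standard $d$-dimensional Brownian motion. $\mathbb{G}=\{\mathcal{G}_t\}_{t\in[0,T]}$ is a given subfiltration: $\mathcal{G}_t\subset\mathcal{F}_t$ for all $t$ and $\mathcal{G}_s\subset\mathcal{G}_t$ for $s\le t$; $\mathbb{G}$ is not assumed to be right-continuous or complete. Spaces: $L^2(\mathcal{F}_T)$ is the set of real $\mathcal{F}_T$-measurable square-integrable random variables; $\mathcal{S}^2$ is the set of real-valued adapted continuous processes $Y$ on $[0,T]$ with $\mathsf{E}[\sup_{t\in[0,T]}|Y_t|^2]<\infty$; $\mathcal{H}^2_d$ is the set of $\mathbb{R}^{1\times d}$-valued (identified with $\mathbb{R}^d$) predictable processes $Z$ with $\mathsf{E}[\int_0^T|Z_t|^2dt]<\infty$. A map $f:\Omega\times[0,T]\times\mathbb{R}\times\mathbb{R}^d\times\mathbb{R}\times\mathbb{R}^d\to\mathbb{R}$ is a standard Lipschitz driver if: for each fixed $(y,z,y',z')$, $f(\cdot,\cdot,y,z,y',z')$ is $\mathbb{F}$-progressively measurable; there is $\lambda>0$ with $|f(t,y_1,z_1,y_1',z_1')-f(t,y_2,z_2,y_2',z_2')|\le\lambda(|y_1-y_2|+|z_1-z_2|+|y_1'-y_2'|+|z_1'-z_2'|)$ for all arguments; and $\mathsf{E}[\int_0^T|f(t,0,0,0,0)|^2dt]<\infty$.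 Conditional expectations of vectors are taken componentwise; the processes $s\mapsto\mathsf{E}[Y_s|\mathcal{G}_s]$, $s\mapsto\mathsf{E}[Z_s|\mathcal{G}_s]$ are understood through $\mathbb{G}$-progressively measurable modifications. $I_A$ is the indicator of $A$. *)

(* Defs.v *)
From HB Require Import structures.
From mathcomp Require Export all_boot all_order all_algebra.
From mathcomp Require Export all_classical all_reals all_analysis.
Export numFieldNormedType.Exports.

Export Order.TTheory GRing.Theory Num.Theory.

#[export] Set Implicit Arguments.
#[export] Unset Strict Implicit.
#[export] Unset Printing Implicit Defensive.

Global Open Scope classical_set_scope.
Global Open Scope ring_scope.

(* Conventions.
   - A stochastic process is a function of time (a real number) first and of
     the outcome second; only times in [0, T] are ever used.
   - A sub-sigma-algebra is a set of sets [H : set (set Omega)]; measurability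
     with respect to it is the library's measurability on
     [g_sigma_algebraType H], whose measurable sets are those of [H] as soon
     as [H] is a sigma-algebra.
   - Vectors are row vectors; measurability, continuity and conditional
     expectation of vectors are taken coordinate by coordinate. *)

(* The Euclidean norm (the library norm on matrices is the sup norm). *)
Definition enorm (R : realType) (d : nat) (z : 'rV[R]_d) : R :=
  Num.sqrt (\sum_(j < d) z 0 j ^+ 2).

Section processes.
Context (dd : measure_display) (Omega : measurableType dd) (R : realType).
Implicit Types (H : set (set Omega)) (F G : R -> set (set Omega)).
Implicit Types (X : R -> Omega -> R) (T : R).

Definition sub_measurable H (X : Omega -> R) : Prop :=
  measurable_fun [set: g_sigma_algebraType H]
    (fun w : g_sigma_algebraType H => X w).

Definition filtration T F : Prop :=
  (forall t, t \in `[0, T] ->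
     sigma_algebra [set: Omega] (F t) /\ F t `<=` measurable) /\
  (forall s t, 0 <= s -> s <= t -> t <= T -> F s `<=` F t).

Definition subfiltration T G F : Prop :=
  filtration T G /\ forall t, t \in `[0, T] -> G t `<=` F t.

(* Negligible sets need not be measurable a priori, so completeness of [F 0]
   includes that of the probability space itself. *)
Definition usual_conditions (P : probability Omega R) T F : Prop :=
  [/\ filtration T F,
      forall t, t \in `[0, T[ ->
        \bigcap_(s in [set s | t < s <= T]) F s `<=` F t
    & forall t N, t \in `[0, T] -> P.-negligible N -> F t N].

Definition adapted T F X : Prop :=
  forall t, t \in `[0, T] -> sub_measurable (F t) (X t).

Definition progressive T F X : Prop :=
  forall t, t \in `[0, T] ->
    measurable_fun (`[0, t] `*` [set: g_sigma_algebraType (F t)])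
      (fun p : R * g_sigma_algebraType (F t) => X p.1 p.2).

Definition predictable_rects T F : set (set (R * Omega)) :=
  [set E | (exists2 A, F 0 A & E = [set 0] `*` A) \/
           (exists s t A,
              [/\ 0 <= s, s <= t, t <= T, F s A & E = `]s, t] `*` A])].

Definition predictable T F X : Prop :=
  forall C : set R, measurable C ->
    <<s `[0, T] `*` [set: Omega], predictable_rects T F >>
      ((`[0, T] `*` [set: Omega]) `&` [set p | C (X p.1 p.2)]).

Definition continuous_process T X : Prop :=
  forall w, {within `[0, T], continuous (fun t => X t w)}.

End processes.

Section spaces.
Context (dd : measure_display) (Omega : measurableType dd) (R : realType).
Context (P : probability Omega R) (T : R) (F : R -> set (set Omega)).
Context (d : nat).

Definition L2 (H : set (set Omega)) (xi : Omega -> R) : Prop :=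
  sub_measurable H xi /\ (\int[P]_w ((xi w) ^+ 2)%:E < +oo)%E.

Definition S2 (Y : R -> Omega -> R) : Prop :=
  [/\ adapted T F Y, continuous_process T Y
    & (\int[P]_w ereal_sup [set (Y t w ^+ 2)%:E | t in `[0%R, T]] < +oo)%E].

(* E[int_0^T |Z_t|^2 dt] *)
Definition H2_sqnorm (Z : R -> Omega -> 'rV[R]_d) : \bar R :=
  (\int[P]_w \int[lebesgue_measure]_(t in `[0%R, T])
     ((enorm (Z t w)) ^+ 2)%:E)%E.

Definition H2 (Z : R -> Omega -> 'rV[R]_d) : Prop :=
  (forall j, predictable T F (fun t w => Z t w 0 j)) /\
  (H2_sqnorm Z < +oo)%E.

(* The last clause says that B_t - B_s is independent of F_s and distributed as
   N(0, (t - s) I_d); the second parameter of [normal_prob] is the standard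
   deviation. *)
Definition brownian_motion (B : R -> Omega -> 'rV[R]_d) : Prop :=
  [/\ {ae P, forall w, B 0 w = 0},
      forall j, adapted T F (fun t w => B t w 0 j),
      forall j, continuous_process T (fun t w => B t w 0 j)
    & forall s t (A : set Omega) (C : 'I_d -> set R),
        0 <= s -> s < t -> t <= T -> F s A -> (forall j, measurable (C j)) ->
        P (A `&` [set w | forall j, C j (B t w 0 j - B s w 0 j)]) =
        (P A * \prod_(j < d) normal_prob 0 (Num.sqrt (t - s)) (C j))%E].

End spaces.

(* The data of the simple integrand
   sum_(k < n) eta_k 1_{]tau_k, tau_(k+1)]}. *)
Record simple_integrand (Omega : Type) (R : realType) (d : nat) :=
  SimpleIntegrand {
    si_n : nat;
    si_tau : nat -> R;
    si_eta : nat -> Omega -> 'rV[R]_d }.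

Section ito.
Context (dd : measure_display) (Omega : measurableType dd) (R : realType).
Context (P : probability Omega R) (T : R) (F : R -> set (set Omega)).
Context (d : nat) (B : R -> Omega -> 'rV[R]_d).
Implicit Types (h : simple_integrand Omega R d).

Definition si_valid h : Prop :=
  [/\ forall k, (k <= si_n h)%N -> si_tau h k \in `[0, T],
      forall k, (k < si_n h)%N -> si_tau h k <= si_tau h k.+1
    & forall k j, (k < si_n h)%N ->
        sub_measurable (F (si_tau h k)) (fun w => si_eta h k w 0 j) /\
        exists M, forall w, `|si_eta h k w 0 j| <= M].

Definition si_value h (t : R) (w : Omega) : 'rV[R]_d :=
  \sum_(k < si_n h)
    (si_tau h k < t <= si_tau h k.+1)%R%:R *: si_eta h k w.

Definition si_integral h (t : R) (w : Omega) : R :=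
  \sum_(k < si_n h) \sum_(j < d)
    si_eta h k w 0 j *
    (B (Num.min (si_tau h k.+1) t) w 0 j - B (Num.min (si_tau h k) t) w 0 j).

(* [ito_integral Z I]: the process I is (a version of) int_0^. Z_s dB_s, i.e.
   the continuous adapted process which is the L^2-limit of the integrals of
   simple integrands approximating Z in H^2. *)
Definition ito_integral (Z : R -> Omega -> 'rV[R]_d) (I : R -> Omega -> R) :
    Prop :=
  [/\ adapted T F I, continuous_process T I
    & exists h : nat -> simple_integrand Omega R d,
        [/\ forall n, si_valid (h n),
            H2_sqnorm P T (fun t w => si_value (h n) t w - Z t w)
              @[n --> \oo] --> 0%E
          & forall t, t \in `[0, T] ->
              (\int[P]_w ((si_integral (h n) t w - I t w) ^+ 2)%:E)%E
                @[n --> \oo] --> 0%E]].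

End ito.

Section conditional_expectation.
Context (dd : measure_display) (Omega : measurableType dd) (R : realType).
Context (P : probability Omega R).

(* V is a version of E[X | H]; in particular X is integrable. *)
Definition is_condexp (H : set (set Omega)) (X V : Omega -> R) : Prop :=
  [/\ P.-integrable [set: Omega] (EFin \o X),
      P.-integrable [set: Omega] (EFin \o V),
      sub_measurable H V
    & forall A, H A -> (\int[P]_(w in A) (V w)%:E = \int[P]_(w in A) (X w)%:E)%E].

(* E[X | H] <= E[X' | H'] almost surely, whenever both sides are defined. *)
Definition condexp_le (H : set (set Omega)) (X : Omega -> R)
    (H' : set (set Omega)) (X' : Omega -> R) : Prop :=
  forall V V', is_condexp H X V -> is_condexp H' X' V' ->
    {ae P, forall w, V w <= V' w}.

(* V is a G-progressively measurable modification of s |-> E[X_s | G_s], the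
   latter being defined at the times s at which X_s is integrable. *)
Definition condexp_process (T : R) (G : R -> set (set Omega))
    (X V : R -> Omega -> R) : Prop :=
  progressive T G V /\
  forall s, s \in `[0, T] -> P.-integrable [set: Omega] (EFin \o X s) ->
    is_condexp (G s) (X s) (V s).

End conditional_expectation.

Section bsde.
Context (dd : measure_display) (Omega : measurableType dd) (R : realType).
Context (P : probability Omega R) (T : R) (F G : R -> set (set Omega)).
Context (d : nat) (B : R -> Omega -> 'rV[R]_d).

Definition driver : Type :=
  R -> Omega -> R -> 'rV[R]_d -> R -> 'rV[R]_d -> R.

Definition standard_lipschitz_driver (f : driver) : Prop :=
  [/\ forall y z y' z', progressive T F (fun t w => f t w y z y' z'),
      exists2 lambda : R, 0 < lambda &
        forall t w y1 z1 y1' z1' y2 z2 y2' z2', t \in `[0, T] ->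
          `|f t w y1 z1 y1' z1' - f t w y2 z2 y2' z2'| <=
          lambda * (`|y1 - y2| + enorm (z1 - z2) +
                    `|y1' - y2'| + enorm (z1' - z2'))
    & (\int[P]_w \int[lebesgue_measure]_(t in `[0%R, T])
         ((f t w 0%R 0%R 0%R 0%R) ^+ 2)%:E < +oo)%E].

(* (Y, Z) solves
     Y_t = xi + int_t^T f(s, Y_s, Z_s, E[Y_s|G_s], E[Z_s|G_s]) ds
              - int_t^T Z_s dB_s + K_T - K_t,
   where EY and EZ are the modifications of E[Y_s|G_s] and E[Z_s|G_s] used, and
   int_t^T Z_s dB_s is I_T - I_t. *)
Definition bsde_solution (f : driver) (xi : Omega -> R) (K : R -> Omega -> R)
    (Y : R -> Omega -> R) (Z : R -> Omega -> 'rV[R]_d)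
    (EY : R -> Omega -> R) (EZ : R -> Omega -> 'rV[R]_d) : Prop :=
  [/\ S2 P T F Y, H2 P T F Z,
      condexp_process P T G Y EY,
      forall j, condexp_process P T G (fun s w => Z s w 0 j)
                                      (fun s w => EZ s w 0 j)
    & exists2 I, ito_integral P T F B Z I &
        forall t, t \in `[0, T] -> {ae P, forall w,
          Y t w = xi w +
            \int[lebesgue_measure]_(s in `[t, T])
               f s w (Y s w) (Z s w) (EY s w) (EZ s w)
            - (I T w - I t w) + K T w - K t w}].

End bsde.

(* Main.v *)
From HB Require Import structures.
Require Import Defs.
From mathcomp Require Import ring lra measurable_realfun.

(* Put y = Y1 - Y2, u_t = E[y_t | G_t] and phi(t) = E[u_t^+]. Integrating the
   difference of the two equations over A = {u_t > 0}, an event of G_t, removes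
   the stochastic integrals; the terminal values and the processes K contribute
   nonpositive terms, since both comparisons can be made after conditioning on
   G_T and G_t. By hypothesis (3) the difference of the drivers at time s can be
   replaced by a_s y_s + b_s u_s. As a_s is G_s-measurable, y_s may be replaced
   by u_s, and (a_s + b_s) u_s <= 2 lambda u_s^+ because 0 <= a_s + b_s.
   Hence phi(t) <= 2 lambda int_t^T phi(s) ds, and phi = 0 by Gronwall. *)

(** * Integrals over a sub-sigma-algebra *)

(** No equation for [u] itself is available, since [u] is only a progressive modification along a
    filtration without regularity; this is why the two equations are tested on a fixed event instead
    of applying an Ito formula to the positive part. The event stays in every G_s with s >= t, so
    hypotheses stated conditionally on G_s can be used under the time integral. As [f2] ignores z,
    linearising its difference leaves no Z term. The coefficients play different parts: [b]
    multiplies [u], which is already an average, so only [a] has to pass through a conditional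
    expectation. The factor 2 lambda adds the bounds of the two difference quotients.

    The Ito integral is specified as an L^2-limit of simple integrals, so its vanishing on events of
    F_t is derived from the independence and symmetry of Brownian increments. Finally, [phi] is only
    known to be bounded above and integrable in time, hence a Gronwall argument without
    continuity. *)

Section integrability.
Context (dd : measure_display) (Omega : measurableType dd) (R : realType).
Context (mu : measure Omega R).
Implicit Types (X Y eta : Omega -> R) (A : set Omega).

Lemma integrable_EFinD A X Y : measurable A ->
  mu.-integrable A (EFin \o X) -> mu.-integrable A (EFin \o Y) ->
  mu.-integrable A (EFin \o (fun w => X w + Y w)).
Proof. by move=> mA iX iY; exact: (integrableD mA iX iY). Qed.

Lemma integrable_EFinB A X Y : measurable A ->
  mu.-integrable A (EFin \o X) -> mu.-integrable A (EFin \o Y) ->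
  mu.-integrable A (EFin \o (fun w => X w - Y w)).
Proof. by move=> mA iX iY; exact: (integrableB mA iX iY). Qed.

Lemma integrable_EFinZ A c X : measurable A ->
  mu.-integrable A (EFin \o X) -> mu.-integrable A (EFin \o (fun w => c * X w)).
Proof. by move=> mA iX; exact: (integrableZl mA c iX). Qed.

Lemma integrable_EFinMb A eta X (M : R) : measurable A ->
  measurable_fun A eta -> (forall w, A w -> `|eta w| <= M) ->
  mu.-integrable A (EFin \o X) ->
  mu.-integrable A (EFin \o (fun w => eta w * X w)).
Proof.
move=> mA meta etaM iX; apply: (integrableMr mA meta _ iX).
exists M; split; first exact: num_real.
by move=> x Mx w Aw; exact: le_trans (etaM _ Aw) (ltW Mx).
Qed.

Lemma integrable_EFin_measurable A X :
  mu.-integrable A (EFin \o X) -> measurable_fun A X.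
Proof. by move=> iX; apply/measurable_EFinP; exact: (measurable_int mu iX). Qed.

Lemma integrable_EFin_sum A (I : Type) (r : seq I) (h : I -> Omega -> R) :
  measurable A -> (forall i, mu.-integrable A (EFin \o h i)) ->
  mu.-integrable A (EFin \o (fun w => \sum_(i <- r) h i w)).
Proof.
move=> mA ih; rewrite (_ : EFin \o _ = fun w => (\sum_(i <- r) (h i w)%:E)%E).
  by apply: (integrable_sum mA) => i _; exact: ih.
by apply/funext => w; rewrite /= sumEFin.
Qed.

Lemma Rintegral_sum A (I : Type) (r : seq I) (h : I -> Omega -> R) :
  measurable A -> (forall i, mu.-integrable A (EFin \o h i)) ->
  \int[mu]_(w in A) (\sum_(i <- r) h i w) =
  \sum_(i <- r) \int[mu]_(w in A) h i w.
Proof.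
move=> mA ih; elim: r => [|i r IH].
  under eq_Rintegral do rewrite big_nil.
  by rewrite big_nil Rintegral_cst// mul0r.
under eq_Rintegral do rewrite big_cons.
by rewrite RintegralD//; [rewrite IH big_cons | exact: integrable_EFin_sum].
Qed.

Lemma Rintegral_indicM A C X :
  \int[mu]_(w in A) (\1_C w * X w) = \int[mu]_(w in A `&` C) X w.
Proof.
rewrite Rintegral_mkcondr; apply: eq_Rintegral => w _.
by rewrite patch_indic /= mulrC.
Qed.

End integrability.

Section threshold.
Context (R : realType).

Lemma threshold_sum_eq (x : R) n : n%:R <= x ->
  \sum_(k < n) (k.+1%:R <= x)%R%:R = n%:R :> R.
Proof.
move=> nx; rewrite (eq_bigr (fun=> 1)); first by rewrite sumr_const card_ord.
by move=> i _; rewrite (le_trans _ nx)// ler_nat.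
Qed.

(* For [0 <= x <= n] the sum is the integer part of [x]. *)
Lemma threshold_sum_approx (x : R) n : 0 <= x -> x <= n%:R ->
  `|x - \sum_(k < n) (k.+1%:R <= x)%R%:R| <= 1.
Proof.
move=> x0; elim: n => [|n IH] xn.
  by rewrite big_ord0 subr0 ger0_norm// (le_trans xn).
have [xn'|nx] := leP x n%:R.
  rewrite big_ord_recr/= [n.+1%:R <= x]leNgt (le_lt_trans xn') ?ltr_nat//.
  by rewrite addr0; exact: IH.
rewrite big_ord_recr/= threshold_sum_eq ?(ltW nx)//.
move: xn; rewrite -natr1 => xn; rewrite ler_norml.
by case: (leP (n%:R + 1) x) => h; apply/andP; split; rewrite /= ?mulr1n ?mulr0n; lra.
Qed.

End threshold.

(** * Orthogonality to a sub-sigma-algebra and existence of conditional expectations *)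

Section sub_sigma_algebra.
Context (dd : measure_display) (Omega : measurableType dd) (R : realType).
Context (P : probability Omega R) (H : set (set Omega)).
Hypotheses (sH : sigma_algebra setT H) (Hm : H `<=` measurable).
Implicit Types (X D eta : Omega -> R) (A : set Omega).

Lemma sub_measurableP X :
  sub_measurable H X <-> forall C, measurable C -> H (X @^-1` C).
Proof.
have E := @measurable_g_measurableTypeE _ H sH.
split=> h.
  move=> C mC; have := h measurableT C mC.
  by rewrite setTI E.
by move=> _ C mC; rewrite setTI E; exact: h.
Qed.

Lemma sub_measurable_measurable X : sub_measurable H X -> measurable_fun setT X.
Proof.
by move=> /sub_measurableP h _ C mC; rewrite setTI; apply: Hm; exact: h.
Qed.

Lemma sub_sigmaT : H setT.
Proof. by case: sH => H0 HC _; rewrite -(setD0 setT); exact: HC. Qed.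

Lemma sub_sigmaI A C : H A -> H C -> H (A `&` C).
Proof.
have E := @measurable_g_measurableTypeE _ H sH.
by rewrite -E; exact: measurableI.
Qed.

Let ge_set eta (c : R) : sub_measurable H eta -> H [set w | c <= eta w].
Proof.
move=> /sub_measurableP h; have := h `[c, +oo[%classic (measurable_itv _).
by congr H; apply/seteqP; split => w /=; rewrite in_itv/= andbT.
Qed.

(** [(n + 1) * eta] is within 1 of a sum of n + 1 indicators of events of [H], against which [D]
    integrates to 0. So n + 1 times the absolute value of the integral is at most the integral of
    [|D|], for every n, and no limit theorem is needed. *)
Let Rintegral_sub_measurableM01 D eta : P.-integrable setT (EFin \o D) ->
  (forall A, H A -> \int[P]_(w in A) D w = 0) ->
  sub_measurable H eta -> (forall w, 0 <= eta w <= 1) ->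
  forall A, H A -> \int[P]_(w in A) (eta w * D w) = 0.
Proof.
move=> iD D0 meta eta01 A HA.
have mA := Hm HA.
have iDA : P.-integrable A (EFin \o D) by exact: integrableS iD.
pose S n w : R := \sum_(k < n) \1_[set w | k.+1%:R <= n%:R * eta w] w.
have Hset n k : H [set w | k.+1%:R <= n.+1%:R * eta w].
  rewrite (_ : [set w | _] = [set w | k.+1%:R / n.+1%:R <= eta w]).
    exact: ge_set.
  by apply/seteqP; split => w /=; rewrite ler_pdivrMr 1?mulrC// ltr0n.
have mS n : measurable_fun setT (S n.+1).
  apply: (@measurable_sum _ Omega R setT _ (index_enum _)
    (fun k : 'I_n.+1 => \1_[set w | k.+1%:R <= n.+1%:R * eta w])) => k.
  by apply: measurable_indic; exact: Hm (Hset _ _).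
have close n w : `|n.+1%:R * eta w - S n.+1 w| <= 1.
  rewrite /S (eq_bigr (fun k : 'I_n.+1 => (k.+1%:R <= n.+1%:R * eta w)%R%:R)).
    have /andP[e0 e1] := eta01 w.
    apply: threshold_sum_approx; first by rewrite mulr_ge0.
    by rewrite ler_piMr.
  move=> k _; rewrite indicE; congr (_%:R); congr nat_of_bool.
  by apply/idP/idP; rewrite inE.
have IS n : \int[P]_(w in A) (S n.+1 w * D w) = 0.
  rewrite /S.
  under eq_Rintegral do rewrite mulr_suml.
  rewrite (Rintegral_sum _ (h := fun k : 'I_n.+1 => fun w =>
    \1_[set w | k.+1%:R <= n.+1%:R * eta w] w * D w))//.
    rewrite big1// => k _; rewrite Rintegral_indicM D0//.
    by apply: sub_sigmaI => //; exact: Hset.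
  move=> k; apply: (@integrable_EFinMb _ _ _ _ _ _ _ 1) => //.
    apply: measurable_indic.
    by apply: Hm; exact: Hset.
  by move=> w _; rewrite indicE; case: (_ \in _); rewrite ?normr0 ?normr1.
have mE : measurable_fun setT eta by exact: sub_measurable_measurable.
have bound n : n.+1%:R * `|\int[P]_(w in A) (eta w * D w)| <= \int[P]_(w in A) `|D w|.
  have ieta : P.-integrable A (EFin \o (fun w => eta w * D w)).
    apply: (@integrable_EFinMb _ _ _ _ _ _ _ 1) => //.
    - exact: measurable_funTS.
    - by move=> w _; have /andP[e0 e1] := eta01 w; rewrite ger0_norm.
  have iSD : P.-integrable A (EFin \o (fun w => S n.+1 w * D w)).
    apply: (@integrable_EFinMb _ _ _ _ _ _ _ (n.+1%:R + 1)) => //.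
    - exact: measurable_funTS.
    - move=> w _; have := close n w; have /andP[e0 e1] := eta01 w.
      have : n.+1%:R * eta w <= n.+1%:R by rewrite ler_piMr.
      have : 0 <= n.+1%:R * eta w by rewrite mulr_ge0.
      by rewrite !ler_norml => *; lra.
  rewrite -[X in X * _](@ger0_norm _ n.+1%:R)// -normrM -RintegralZl//.
  rewrite -[X in `|X|]subr0 -(IS n) -RintegralB//; last exact: integrable_EFinZ.
  apply: le_trans.
    apply: le_normr_Rintegral => //.
    by apply: integrable_EFinB => //; exact: integrable_EFinZ.
  apply: le_Rintegral => //.
  - apply: integrable_norm.
    by apply: integrable_EFinB => //; exact: integrable_EFinZ.
  - exact: integrable_norm.
  - move=> w _; rewrite mulrA -mulrBl normrM.
    by rewrite ler_piMl.
apply/eqP; rewrite -normr_eq0; apply/eqP/le_anti; rewrite normr_ge0 andbT.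
rewrite leNgt; apply/negP => I0.
(* By the Archimedean property some n + 1 exceeds this quotient, which contradicts [bound]. *)
pose c := \int[P]_(w in A) `|D w| / `|\int[P]_(w in A) (eta w * D w)|.
have := bound (Num.truncn c).
rewrite -ler_pdivlMr// leNgt => /negP; apply.
by rewrite -/c; have := truncnS_gt c.
Qed.

Lemma Rintegral_sub_measurableM D eta M : P.-integrable setT (EFin \o D) ->
  (forall A, H A -> \int[P]_(w in A) D w = 0) ->
  sub_measurable H eta -> (forall w, `|eta w| <= M) ->
  forall A, H A -> \int[P]_(w in A) (eta w * D w) = 0.
Proof.
move=> iD D0 meta etaM A HA.
have mA := Hm HA.
have iDA : P.-integrable A (EFin \o D) by exact: integrableS iD.
(* An affine change maps [-N, N] onto [0, 1]; adding 1 keeps it invertible when [M = 0]. *)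
pose N := `|M| + 1.
have N0 : 0 < N by rewrite ltr_wpDl.
have etaN w : `|eta w| <= N.
  by rewrite (le_trans (etaM w))// (le_trans (ler_norm _))// lerDl.
pose e w := (eta w + N) / (2 * N).
have -> : \int[P]_(w in A) (eta w * D w) =
          \int[P]_(w in A) (2 * N * (e w * D w) - N * D w).
  apply: eq_Rintegral => w _; rewrite /e mulrA mulrCA divff ?mulr1; first by lra.
  by rewrite mulf_neq0// gt_eqF.
have me : sub_measurable H e.
  apply: measurable_funM; last exact: measurable_cst.
  by apply: measurable_funD => //; exact: measurable_cst.
have e01 w : 0 <= e w <= 1.
  have := etaN w; rewrite ler_norml => /andP[h1 h2].
  rewrite /e divr_ge0 ?ler_pdivrMr ?mulr_gt0//=; last 2 first.
  - by rewrite -lerBlDr sub0r.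
  - by rewrite mulr_ge0// ltW.
  lra.
have ie : P.-integrable A (EFin \o (fun w => e w * D w)).
  apply: (@integrable_EFinMb _ _ _ _ _ _ _ 1) => //.
  - by apply: measurable_funTS; exact: sub_measurable_measurable.
  - by move=> w _; have /andP[e0 e1] := e01 w; rewrite ger0_norm.
rewrite RintegralB//; [|exact: integrable_EFinZ..].
rewrite !RintegralZl// D0// (Rintegral_sub_measurableM01 iD D0 me e01 HA).
by rewrite !mulr0 subrr.
Qed.

Lemma condexp_Rintegral X V : is_condexp P H X V ->
  forall A, H A -> \int[P]_(w in A) V w = \int[P]_(w in A) X w.
Proof. by move=> [_ _ _ VX] A HA; rewrite /Rintegral VX. Qed.


(* The identity, seen as a measurable map onto the coarser measurable space:
   its law is P restricted to H. *)
Definition coarsen (w : Omega) : g_sigma_algebraType H := w.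

Lemma coarsen_measurable : measurable_fun setT coarsen.
Proof.
move=> _ A; rewrite (measurable_g_measurableTypeE sH) => HA.
by rewrite setTI; exact: Hm.
Qed.

(** Radon-Nikodym on the coarser space: the charge with density [X], pushed forward along [coarsen],
    is dominated by the law of [coarsen], and its derivative is [H]-measurable by construction. *)
Lemma condexp_exists X : P.-integrable setT (EFin \o X) ->
  exists V, is_condexp P H X V.
Proof.
move=> iX.
have mc := coarsen_measurable.
pose c : {mfun Omega >-> g_sigma_algebraType H} :=
  HB.pack coarsen (isMeasurableFun.Build _ _ _ _ coarsen mc).
pose Q := distribution P c.
pose nu : {charge set (g_sigma_algebraType H) -> \bar R} :=
  measure_function_pushforward__canonical__charge_Charge (induced_charge iX) mc.
have nuQ : nu `<< Q.
  apply/null_content_dominatesP => A mA QA.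
  apply: null_set_integral => //.
    by apply: Hm; rewrite -(measurable_g_measurableTypeE sH).
  by apply: measurable_funTS; exact: (measurable_int P iX).
pose f := Radon_Nikodym nu Q.
have fE A : H A -> (\int[P]_(w in A) (X w)%:E = \int[Q]_(w in A) f w)%E.
  move=> HA; have mA : measurable (A : set (g_sigma_algebraType H)).
    by rewrite (measurable_g_measurableTypeE sH).
  by rewrite -(Radon_Nikodym_integral nuQ mA).
have iQ : Q.-integrable setT f by exact: Radon_Nikodym_integrable.
have ffin w : f w \is a fin_num by exact: Radon_Nikodym_fin_num.
have mf : measurable_fun setT f by exact: (measurable_int Q iQ).
have mfO : measurable_fun setT (f \o coarsen) by exact: measurableT_comp.
have iP : P.-integrable setT (f \o coarsen).
  apply/integrableP; split => //.
  have /integrableP[_] := iQ.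
  by rewrite (ge0_integral_distribution c)//; exact: measurableT_comp.
exists (fun w => fine (f w)).
have fineE : EFin \o (fun w => fine (f w)) = f \o coarsen.
  by apply/funext => w /=; rewrite fineK.
split=> //.
- by rewrite fineE.
- by apply/measurable_EFinP; rewrite fineE.
- move=> A HA; rewrite fE//.
  have mA : measurable (A : set (g_sigma_algebraType H)).
    by rewrite (measurable_g_measurableTypeE sH).
  rewrite integral_pushforward//; last first.
    by apply: integrableS iP => //; exact: Hm.
  by apply: eq_integral => w _; rewrite /= fineK.
Qed.


End sub_sigma_algebra.

(** * Brownian increments *)

Section normal.
Context (R : realType).
Notation leb := (@lebesgue_measure R).

(** The Radon-Nikodym derivative of the normal law and [normal_pdf] have the same integral over
    every measurable set, so they agree almost everywhere. *)
Lemma ge0_integral_normal_prob (m s : R) (f : R -> \bar R) :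
  measurable_fun setT f -> (forall x, 0 <= f x)%E ->
  (\int[normal_prob m s]_x f x = \int[leb]_x (f x * (normal_pdf m s x)%:E))%E.
Proof.
move=> mf f0.
have dom := normal_prob_dominates m s.
rewrite -(Radon_Nikodym_SigmaFinite.change_of_variables dom)//.
have irn := Radon_Nikodym_SigmaFinite.f_integrable dom.
have mpdf : measurable_fun setT (fun x => (normal_pdf m s x)%:E).
  by apply/measurable_EFinP; exact: measurable_normal_pdf.
apply: ae_eq_integral => //.
- by apply: emeasurable_funM => //; exact: (measurable_int leb irn).
- exact: emeasurable_funM.
- apply: ae_eqe_mul2l; apply: integral_ae_eq => // E _ mE.
  by rewrite -Radon_Nikodym_SigmaFinite.f_integral.
Qed.

Lemma normal_prob_absolute_moment_lty (s : R) : s != 0 ->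
  (\int[normal_prob 0 s]_x `|x|%:E < +oo)%E.
Proof.
move=> s0; have s2 : 2 * s != 0 by rewrite mulf_neq0.
rewrite ge0_integral_normal_prob//; last first.
  by apply/measurable_EFinP; exact: normr_measurable.
(* Chosen so that 1 / k = 1 / (2 s^2) - 1 / (8 s^2), the gap between the exponents of deviations [s]
   and [2 s]. In [c], the factor 1 + k comes from |x| <= (1 + k) (1 + x^2 / k) <= (1 + k) exp (x^2 /
   k), and the quotient of peaks matches the normalisations. *)
pose k := 8 / 3 * s ^+ 2.
have k0 : 0 < k by rewrite mulr_gt0// exprn_even_gt0.
pose c := (1 + k) * (normal_peak s / normal_peak (2 * s)).
have c0 : 0 <= c by rewrite mulr_ge0 ?addr_ge0 ?ltW// divr_gt0// normal_peak_gt0.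
apply: (@le_lt_trans _ _ (\int[leb]_x (c * normal_pdf 0 (2 * s) x)%:E)%E).
  apply: ge0_le_integral => //.
  - by move=> x _; rewrite -EFinM lee_fin mulr_ge0// normal_pdf_ge0.
  - apply: emeasurable_funM; apply/measurable_EFinP; first exact: normr_measurable.
    exact: measurable_normal_pdf.
  - apply/measurable_EFinP; apply: measurable_funM => //.
    exact: measurable_normal_pdf.
  move=> x _; rewrite -EFinM lee_fin !normal_pdfE//.
  have p0 := normal_peak_gt0 s0; have q0 := normal_peak_gt0 s2.
  rewrite [leRHS]mulrA /c -(mulrA (1 + k)) divfK ?gt_eqF//.
  rewrite mulrCA [leRHS]mulrAC [leRHS]mulrC ler_pM2l//.
  rewrite /normal_fun subr0.
  have -> : - x ^+ 2 / ((2 * s) ^+ 2 *+ 2) =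
            - x ^+ 2 / (s ^+ 2 *+ 2) + x ^+ 2 / k.
    by rewrite /k; field.
  rewrite expRD [leLHS]mulrC mulrCA ler_pM2l ?expR_gt0//.
  (* The density of deviation [s] is [exp (- x^2 / k)] times, up to a constant,
     the one of deviation [2 s]. *)
  apply: (@le_trans _ _ ((1 + k) * (1 + x ^+ 2 / k))); last first.
    by rewrite ler_pM2l ?expR_ge1Dx// ltr_wpDr// ltW.
  have -> : (1 + k) * (1 + x ^+ 2 / k) = 1 + x ^+ 2 + k + x ^+ 2 / k.
    by rewrite /k; field.
  have : 0 <= x ^+ 2 / k by rewrite divr_ge0 ?sqr_ge0// ltW.
  have : 0 <= (`|x| - 1) ^+ 2 by exact: sqr_ge0.
  rewrite -(real_normK (num_real x)).
  by have := normr_ge0 x; nra.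
under eq_integral do rewrite EFinM.
rewrite ge0_integralZl_EFin//.
- by rewrite integral_normal_pdf mule1 ltry.
- by move=> x _; rewrite lee_fin normal_pdf_ge0.
- by apply/measurable_EFinP; exact: measurable_normal_pdf.
Qed.

Lemma normal_prob_oppr (s : R) (C : set R) : s != 0 -> measurable C ->
  normal_prob 0 s (-%R @^-1` C) = normal_prob 0 s C.
Proof.
move=> s0 mC; rewrite /normal_prob.
have even x : normal_pdf 0 s x = normal_pdf 0 s (- x).
  by rewrite !normal_pdfE// /normal_fun !subr0 sqrrN.
pose opp : measurableTypeR R -> measurableTypeR R := -%R.
have mopp : measurable_fun setT opp by exact: oppr_measurable.
transitivity (\int[pushforward leb opp]_(y in C) (normal_pdf 0 s y)%:E)%E.
  rewrite (ge0_integral_pushforward mopp)//.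
  - by apply: eq_integral => x _ /=; rewrite -even.
  - by apply: measurable_funTS; apply/measurable_EFinP; exact: measurable_normal_pdf.
  - by move=> y _; rewrite lee_fin normal_pdf_ge0.
by apply: eq_measure_integral => A mA _; exact: lebesgue_measureN.
Qed.

End normal.

Section law.
Context (dd : measure_display) (Omega : measurableType dd) (R : realType).
Context (P : probability Omega R).

(** An expectation depends only on the law, so here it equals its own opposite. This centres
    Brownian increments without computing a Gaussian mean. *)
Lemma Rintegral_symmetric_law (X : Omega -> R) :
  P.-integrable setT (EFin \o X) ->
  (forall C : set R, measurable C -> P [set w | C (- X w)] = P (X @^-1` C)) ->
  \int[P]_w X w = 0.
Proof.
move=> iX symX.
have mX := integrable_EFin_measurable iX.
have mNX : measurable_fun setT (-%R \o X).
  by apply: measurableT_comp => //; exact: oppr_measurable.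
have mE : measurable_fun [set: R] (EFin : R -> \bar R) by apply/measurable_EFinP.
have E : (\int[P]_w (X w)%:E = \int[P]_w (- X w)%:E)%E.
  transitivity (\int[pushforward P X]_x x%:E)%E.
    by rewrite (integral_pushforward mX).
  transitivity (\int[pushforward P (-%R \o X)]_x x%:E)%E.
    apply: eq_measure_integral => C mC _.
    exact/esym/symX.
  rewrite (integral_pushforward mNX)//.
  have := integrableN iX.
  by apply: eq_integrable => // w _; rewrite /= EFinN.
have : \int[P]_w X w = - \int[P]_w X w.
  rewrite {1}/Rintegral E.
  have -> : (\int[P]_w (- X w)%:E = - \int[P]_w (X w)%:E)%E.
    rewrite -integralN//; last exact: integrable_add_def.
  by rewrite /Rintegral fineN.
by move=> ?; lra.
Qed.

Lemma measurable_probability_split (A E : set Omega) :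
  measurable A -> measurable E -> P E = (P (A `&` E) + P (~` A `&` E))%E.
Proof.
move=> mA mE; rewrite -measureU//; first by rewrite -setIUl setUCr setTI.
- exact: measurableI.
- by apply: measurableI => //; exact: measurableC.
- by rewrite setIACA setICr set0I.
Qed.

End law.

Section filtration.
Context (dd : measure_display) (Omega : measurableType dd) (R : realType).
Context (T : R) (F : R -> set (set Omega)) (filF : filtration T F).

Lemma filtration_sigma t : t \in `[0, T] -> sigma_algebra setT (F t).
Proof. by move=> /(filF.1 t)[]. Qed.

Lemma filtration_measurable t : t \in `[0, T] -> F t `<=` measurable.
Proof. by move=> /(filF.1 t)[]. Qed.

Lemma filtration_sub_measurable t (X : Omega -> R) : t \in `[0, T] ->
  sub_measurable (F t) X -> measurable_fun setT X.
Proof.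
move=> tT; apply: sub_measurable_measurable.
  exact: filtration_sigma.
exact: filtration_measurable.
Qed.

End filtration.

(** * Brownian increments: law, integrability and centring on past events *)

Section brownian.
Context (dd : measure_display) (Omega : measurableType dd) (R : realType).
Context (P : probability Omega R) (T : R) (F : R -> set (set Omega)).
Context (filF : filtration T F) (d : nat) (B : R -> Omega -> 'rV[R]_d).
Hypothesis BM : brownian_motion P T F B.

Lemma brownian_measurable t j : t \in `[0, T] ->
  measurable_fun setT (fun w => B t w 0 j).
Proof.
move=> tT; have [_ aB _ _] := BM.
by apply: (filtration_sub_measurable filF tT); exact: aB.
Qed.

Section increment.
Context (s t : R) (j : 'I_d).
Hypotheses (s0 : 0 <= s) (st : s < t) (tT : t <= T).
Let D w := B t w 0 j - B s w 0 j.

Let sT : s \in `[0, T]. Proof. by rewrite in_itv/= s0/= (le_trans (ltW st)). Qed.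
Let tT' : t \in `[0, T]. Proof. by rewrite in_itv/= (le_trans s0 (ltW st)). Qed.

Let mD : measurable_fun setT D.
Proof. by apply: measurable_funB; exact: brownian_measurable. Qed.

Let sd0 : Num.sqrt (t - s) != 0.
Proof. by rewrite gt_eqF// sqrtr_gt0 subr_gt0. Qed.

Lemma brownian_increment_law (A : set Omega) (C : set R) :
  F s A -> measurable C ->
  P (A `&` D @^-1` C) = (P A * normal_prob 0 (Num.sqrt (t - s)) C)%E.
Proof.
move=> FA mC; have [_ _ _ law] := BM.
(* Full sets in the other coordinates reduce the product of normal probabilities to its factor at
   [j]. *)
have := law s t A (fun i => if i == j then C else setT) s0 st tT FA.
have -> : [set w | forall i, (if i == j then C else setT) (B t w 0 i - B s w 0 i)]
    = D @^-1` C.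
  apply/seteqP; split => w /=; first by move=> /(_ j); rewrite eqxx.
  by move=> Cw i; case: eqP => // ->.
move=> ->; last by move=> i; case: ifP.
congr (_ * _)%E; rewrite (bigD1 j)//= eqxx big1 ?mule1// => i /negbTE ->.
by rewrite probability_setT.
Qed.

Lemma brownian_increment_integrable : P.-integrable setT (EFin \o D).
Proof.
apply/integrableP; split; first exact/measurable_EFinP.
pose D' : Omega -> measurableTypeR R := D.
have mD' : measurable_fun setT D' by exact: mD.
have mabs : measurable_fun [set: measurableTypeR R] (fun x : R => `|x|%:E).
  by apply/measurable_EFinP; exact: normr_measurable.
have -> : (\int[P]_w `|(EFin \o D) w| = \int[pushforward P D']_x `|x|%:E)%E.
  by rewrite (ge0_integral_pushforward mD').
apply: le_lt_trans (normal_prob_absolute_moment_lty sd0).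
rewrite le_eqVlt; apply/orP; left; apply/eqP.
apply: eq_measure_integral => C mC _.
have := brownian_increment_law (sub_sigmaT (filtration_sigma filF sT)) mC.
by rewrite setTI probability_setT mul1e.
Qed.

(** The product of [D] with the indicator of [A] has a symmetric law: on [A], independence from F_s
    reduces it to the symmetry of the normal law, and off [A] it vanishes. *)
Lemma brownian_increment_centered (A : set Omega) : F s A ->
  \int[P]_(w in A) D w = 0.
Proof.
move=> FA; have mA := filtration_measurable filF sT FA.
rewrite -[A]setTI -Rintegral_indicM.
have mind : measurable_fun setT (\1_A : Omega -> R) by exact: measurable_indic.
have mE : measurable_fun setT (fun w => \1_A w * D w) by exact: measurable_funM.
apply: Rintegral_symmetric_law.
  apply: (@integrable_EFinMb _ _ _ _ _ _ _ 1) => //.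
    by move=> w _; rewrite indicE; case: (_ \in _); rewrite ?normr0 ?normr1.
  exact: brownian_increment_integrable.
move=> C mC.
have mNC : measurable ((fun x : R => - x) @^-1` C).
  by rewrite -[X in measurable X]setTI; exact: oppr_measurable.
(* Either everything or nothing, according to whether 0 lies in [C]: the contribution of the
   complement of [A], common to the variable and its opposite. *)
pose C0 := [set _ : Omega | C 0].
have split_law (f : R -> R) (g : Omega -> R) :
    measurable_fun setT g -> (forall w, A w -> g w = f (D w)) ->
    (forall w, ~ A w -> g w = 0) ->
    P (g @^-1` C) = (P (A `&` D @^-1` (f @^-1` C)) + P (~` A `&` C0))%E.
  move=> mg gA gNA.
  rewrite (measurable_probability_split P mA); last first.
    by rewrite -[X in measurable X]setTI; exact: mg.
  congr (P _ + P _)%E; apply/seteqP; split=> w [Aw /=] h; split => //=.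
  - by rewrite -gA.
  - by rewrite gA.
  - by rewrite /C0/= -(gNA w).
  - by rewrite gNA.
have ind1 w : A w -> \1_A w * D w = D w.
  by move=> Aw; rewrite indicE mem_set// mul1r.
have ind0 w : ~ A w -> \1_A w * D w = 0.
  by move=> Aw; rewrite indicE memNset// mul0r.
rewrite (split_law id (fun w => \1_A w * D w))//.
transitivity (P ((fun w => - (\1_A w * D w)) @^-1` C)); first by [].
rewrite (split_law -%R)//; last 3 first.
- by apply: measurableT_comp => //; exact: oppr_measurable.
- by move=> w Aw; rewrite ind1.
- by move=> w Aw; rewrite ind0// oppr0.
rewrite !brownian_increment_law//; congr (_ * _ + _)%E.
exact: normal_prob_oppr.
Qed.

End increment.

End brownian.

(** * The Ito integral is a martingale *)

Section second_moment.
Context (dd : measure_display) (Omega : measurableType dd) (R : realType).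
Context (P : probability Omega R).
Implicit Types X : Omega -> R.

Lemma integrable_probability_cst (c : R) : P.-integrable setT (EFin \o cst c).
Proof. exact: finite_measure_integrable_cst. Qed.

Lemma Rintegral_probability_cst (c : R) : \int[P]_(w in setT) c = c.
Proof.
rewrite Rintegral_cst// -[RHS]mulr1; congr (_ * _).
exact: (congr1 fine (probability_setT P)).
Qed.

Lemma integrable_sqr X : measurable_fun setT X ->
  (\int[P]_w (X w ^+ 2)%:E < +oo)%E -> P.-integrable setT (EFin \o (fun w => X w ^+ 2)).
Proof.
move=> mX fin; apply/integrableP; split.
  by apply/measurable_EFinP; exact: measurable_funX.
by under eq_integral => w _ do rewrite /= ger0_norm ?sqr_ge0//.
Qed.

Lemma sqr_integrable X : measurable_fun setT X ->
  (\int[P]_w (X w ^+ 2)%:E < +oo)%E -> P.-integrable setT (EFin \o X).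
Proof.
move=> mX fin; have i2 := integrable_sqr mX fin.
have i12 := integrable_EFinD measurableT (integrable_probability_cst 1) i2.
apply: le_integrable i12 => //.
  exact/measurable_EFinP.
move=> w _; rewrite /= lee_fin.
rewrite [leRHS]ger0_norm ?addr_ge0 ?sqr_ge0// -(real_normK (num_real (X w))).
have := normr_ge0 (X w); have : 0 <= (`|X w| - 1) ^+ 2 by exact: sqr_ge0.
by nra.
Qed.

(* [|x| <= e + x^2 / e] *)
Lemma Rintegral_norm_le_of_sqr X (e : R) : 0 < e -> measurable_fun setT X ->
  (\int[P]_w (X w ^+ 2)%:E <= (e ^+ 2)%:E)%E ->
  \int[P]_w `|X w| <= 2 * e.
Proof.
move=> e0 mX Xe; have fin : (\int[P]_w (X w ^+ 2)%:E < +oo)%E.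
  by apply: le_lt_trans Xe _; exact: ltry.
have i2 := integrable_sqr mX fin.
have i1 := sqr_integrable mX fin.
have iZ := integrable_EFinZ e^-1 measurableT i2.
apply: (@le_trans _ _ (\int[P]_w (e + e^-1 * X w ^+ 2))).
  apply: le_Rintegral => //.
  - exact: integrable_norm.
  - by apply: integrable_EFinD => //; exact: integrable_probability_cst.
  move=> w _; rewrite -(real_normK (num_real (X w))).
  have := normr_ge0 (X w); set x := `|X w| => x0.
  rewrite -(ler_pM2l e0) mulrDr mulrA divff ?gt_eqF// mul1r.
  have : 0 <= (x - e) ^+ 2 by exact: sqr_ge0.
  by nra.
rewrite RintegralD//; last exact: integrable_probability_cst.
rewrite Rintegral_probability_cst RintegralZl// mulrDl mul1r lerD2l.
rewrite ler_pdivrMl// -expr2 /Rintegral.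
have : (fine (\int[P]_w (X w ^+ 2)%:E)%E)%:E = (\int[P]_w (X w ^+ 2)%:E)%E.
  by rewrite fineK//; exact: integrable_fin_num.
by move=> E; rewrite -lee_fin E.
Qed.

End second_moment.

Section ito.
Context (dd : measure_display) (Omega : measurableType dd) (R : realType).
Context (P : probability Omega R) (T : R) (F : R -> set (set Omega)).
Context (filF : filtration T F) (d : nat) (B : R -> Omega -> 'rV[R]_d).
Hypothesis BM : brownian_motion P T F B.

Lemma brownian_increment_integrable_le s t j : 0 <= s -> s <= t -> t <= T ->
  P.-integrable setT (EFin \o (fun w => B t w 0 j - B s w 0 j)).
Proof.
move=> s0; rewrite le_eqVlt => /predU1P[<- _|st tT].
  rewrite (_ : EFin \o _ = EFin \o cst 0); first exact: integrable_probability_cst.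
  by apply/funext => w /=; rewrite subrr.
exact: (brownian_increment_integrable filF BM j s0 st tT).
Qed.

Section simple.
Variables (h : simple_integrand Omega R d) (hv : si_valid T F h).

Lemma si_integral_integrable t : t \in `[0, T] ->
  P.-integrable setT (EFin \o si_integral B h t).
Proof.
move=> /[dup] tT; rewrite in_itv/= => /andP[t0 tT'].
have [tauT tauS etaP] := hv.
apply: integrable_EFin_sum => // -[k kn].
apply: integrable_EFin_sum => // j.
have [meta [M etaM]] := etaP k j kn.
have := tauT k (ltnW kn); rewrite in_itv/= => /andP[tau0 tau1].
apply: (@integrable_EFinMb _ _ _ _ _ _ _ M) => //.
  exact: (filtration_sub_measurable filF (tauT k (ltnW kn)) meta).
apply: brownian_increment_integrable_le.
- by rewrite le_min tau0 t0.
- by rewrite le_min !ge_min tauS// lexx orbT.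
- by rewrite ge_min tT' orbT.
Qed.

(** What the integral gains after [r] is a sum of increments starting at max(tau_k, r). At that time
    both [A] and the coefficient are already known, and the coefficient is bounded, so each term
    integrates to 0 over [A]. *)
Lemma si_integral_martingale r A : r \in `[0, T] -> F r A ->
  \int[P]_(w in A) (si_integral B h T w - si_integral B h r w) = 0.
Proof.
move=> /[dup] rT; rewrite in_itv/= => /andP[r0 rT'] FA.
have [tauT tauS etaP] := hv.
have mA := filtration_measurable filF rT FA.
pose m k := Num.max (si_tau h k) r.
(* The part of the k-th increment lying after [r], null when the k-th interval ends by then or is
   empty. *)
pose D (k : 'I_(si_n h)) j : Omega -> R :=
  if m k < si_tau h k.+1 then fun w => B (si_tau h k.+1) w 0 j - B (m k) w 0 j
  else cst 0.
have mkT k : (k < si_n h)%N -> 0 <= m k /\ m k \in `[0, T].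
  move=> kn; have := tauT k (ltnW kn); rewrite !in_itv/= => /andP[tau0 tau1].
  by rewrite le_max tau0 ge_max tau1 rT'.
have DE w : si_integral B h T w - si_integral B h r w =
    \sum_(k < si_n h) \sum_(j < d) si_eta h k w 0 j * D k j w.
  rewrite /si_integral -sumrB; apply: eq_bigr => -[k kn] _.
  rewrite -sumrB; apply: eq_bigr => j _; rewrite /= -mulrBr; congr (_ * _).
  rewrite /D /m /=.
  have := tauT k (ltnW kn); have := tauT k.+1 kn; rewrite !in_itv/=.
  move=> /andP[a0 a1] /andP[b0 b1]; have ab := tauS k kn.
  rewrite (min_idPl a1) (min_idPl b1).
  have [h1|h1] := leP (si_tau h k) r; have [h2|h2] := leP (si_tau h k.+1) r.
  - by rewrite /=; ring.
  - by rewrite /=; ring.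
  - by have := le_lt_trans h2 h1; rewrite ltNge ab.
  - case: ltP => h3 /=; first by ring.
    have -> : si_tau h k.+1 = si_tau h k by apply/le_anti; rewrite h3 ab.
    by ring.
have iD k j : P.-integrable setT (EFin \o D k j).
  rewrite /D; case: ifP => km; last exact: integrable_probability_cst.
  have [m0 _] := mkT k (ltn_ord k).
  apply: brownian_increment_integrable_le => //; first exact: ltW.
  by have := tauT k.+1 (ltn_ord k); rewrite in_itv/= => /andP[].
have D0 (k : 'I_(si_n h)) j C : F (m k) C -> \int[P]_(w in C) D k j w = 0.
  have [m0 mT] := mkT k (ltn_ord k).
  move=> FC; rewrite /D; case: ifP => km; last first.
    apply: (etrans (Rintegral_cst P (filtration_measurable filF mT FC) 0)).
    by rewrite mul0r.
  apply: (brownian_increment_centered filF BM j m0 km) => //.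
  by have := tauT k.+1 (ltn_ord k); rewrite in_itv/= => /andP[].
have FmA k : (k < si_n h)%N -> F (m k) A.
  move=> kn; have [m0 mT] := mkT k kn.
  apply: (filF.2 r) FA => //; first by rewrite le_max lexx orbT.
  by move: mT; rewrite in_itv/= => /andP[].
have meta k j : (k < si_n h)%N -> sub_measurable (F (m k)) (fun w => si_eta h k w 0 j).
  move=> kn; have [m0 mT] := mkT k kn.
  have [meta _] := etaP k j kn.
  have tk := tauT k (ltnW kn).
  apply/(sub_measurableP (filtration_sigma filF mT)) => C mC.
  have := (sub_measurableP (filtration_sigma filF tk) _).1 meta C mC.
  move: tk mT; rewrite !in_itv/= => /andP[? ?] /andP[? ?].
  by apply: (filF.2 (si_tau h k)) => //; rewrite le_max lexx.
have ieD (k : 'I_(si_n h)) j :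
    P.-integrable A (EFin \o (fun w => si_eta h k w 0 j * D k j w)).
  have [_ [M etaM]] := etaP k j (ltn_ord k).
  have [m0 mT] := mkT k (ltn_ord k).
  apply: (@integrable_EFinMb _ _ _ _ _ _ _ M) => //.
    by apply: measurable_funTS; apply: (filtration_sub_measurable filF mT); exact: meta.
  exact: integrableS (iD k j).
under eq_Rintegral do rewrite DE.
rewrite (Rintegral_sum _ (h := fun k : 'I_(si_n h) => fun w =>
  \sum_(j < d) si_eta h k w 0 j * D k j w))//; last first.
  by move=> k; apply: integrable_EFin_sum => // j; exact: ieD.
rewrite big1// => k _.
rewrite (Rintegral_sum _ (h := fun j : 'I_d => fun w => si_eta h k w 0 j * D k j w))//.
rewrite big1// => j _.
have [_ [M etaM]] := etaP k j (ltn_ord k).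
have [m0 mT] := mkT k (ltn_ord k).
have sF := filtration_sigma filF mT; have mF := filtration_measurable filF mT.
apply: (Rintegral_sub_measurableM sF mF (iD k j) _ (meta k j (ltn_ord k)) etaM).
- by move=> C; exact: D0.
- exact: FmA.
Qed.

End simple.

Variables (Z : R -> Omega -> 'rV[R]_d) (I : R -> Omega -> R).
Hypothesis itoI : ito_integral P T F B Z I.

Lemma ito_integral_measurable t : t \in `[0, T] -> measurable_fun setT (I t).
Proof.
move=> tT; have [aI _ _] := itoI.
exact: (filtration_sub_measurable filF tT (aI t tT)).
Qed.

(** The L^2-distance to the approximations is eventually finite, so [I t] differs from some
    integrable simple integral by a square-integrable variable. *)
Lemma ito_integral_integrable t : t \in `[0, T] ->
  P.-integrable setT (EFin \o I t).
Proof.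
move=> tT; have [_ _ [h [hv _ /(_ t tT) cvg]]] := itoI.
have [fin _] := (fine_cvgP _ _).1 cvg.
have [N _ /(_ N (leqnn N)) finN] := fin.
have mI := ito_integral_measurable tT.
have iS := si_integral_integrable (hv N) tT.
have mS := integrable_EFin_measurable iS.
have mSI := measurable_funB mS mI.
have iSI : P.-integrable setT (EFin \o (fun w => si_integral B (h N) t w - I t w)).
  by apply: sqr_integrable mSI _; rewrite ltey_eq finN.
have := integrable_EFinB measurableT iS iSI.
by apply: eq_integrable => // w _ /=; congr EFin; ring.
Qed.

(** The identity holds for the simple integrals and survives the limit, because L^2-convergence at
    the two times [T] and [r] implies convergence of integrals over [A]. *)
Lemma ito_integral_martingale r A : r \in `[0, T] -> F r A ->
  \int[P]_(w in A) (I T w - I r w) = 0.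
Proof.
move=> rT FA; have [_ _ [h [hv _ cvg]]] := itoI.
have TT : T \in `[0, T].
  by move: rT; rewrite !in_itv/= => /andP[a b]; rewrite lexx (le_trans a).
have mA := filtration_measurable filF rT FA.
apply/eqP; rewrite -normr_le0; apply/ler_addgt0Pr => e e0; rewrite add0r.
(* An L^2-error e / 4 gives an L^1-error at most e / 2 by [Rintegral_norm_le_of_sqr], and there are
   two such errors. *)
have e4 : 0 < e / 4 by rewrite divr_gt0.
have small t : t \in `[0, T] -> \forall n \near \oo,
    (\int[P]_w ((si_integral B (h n) t w - I t w) ^+ 2)%:E <= ((e / 4) ^+ 2)%:E)%E.
  move=> tT; have [fin /cvgr_le] := (fine_cvgP _ _).1 (cvg t tT).
  move=> /(_ ((e / 4) ^+ 2)); rewrite exprn_gt0// => /(_ erefl) le.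
  near=> n; rewrite -[leLHS]fineK ?lee_fin; near: n => //.
have [n [hT hr]] : exists n,
   (\int[P]_w ((si_integral B (h n) T w - I T w) ^+ 2)%:E <= ((e / 4) ^+ 2)%:E)%E /\
   (\int[P]_w ((si_integral B (h n) r w - I r w) ^+ 2)%:E <= ((e / 4) ^+ 2)%:E)%E.
  have : \forall n \near \oo,
   (\int[P]_w ((si_integral B (h n) T w - I T w) ^+ 2)%:E <= ((e / 4) ^+ 2)%:E)%E /\
   (\int[P]_w ((si_integral B (h n) r w - I r w) ^+ 2)%:E <= ((e / 4) ^+ 2)%:E)%E.
    by near=> n; split; near: n; exact: small.
  by case=> N _ /(_ N (leqnn N)); exists N.
pose X t w := si_integral B (h n) t w - I t w.
have iS t : t \in `[0, T] -> P.-integrable setT (EFin \o si_integral B (h n) t).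
  by move=> tT; apply: (si_integral_integrable (hv n) tT).
have iX t : t \in `[0, T] -> P.-integrable setT (EFin \o X t).
  by move=> tT; apply: integrable_EFinB => //; [exact: iS|exact: ito_integral_integrable].
have XA t : t \in `[0, T] -> `|\int[P]_(w in A) X t w| <= \int[P]_w `|X t w|.
  move=> tT; have iXA : P.-integrable A (EFin \o X t) by apply: integrableS (iX t tT).
  apply: le_trans (le_normr_Rintegral mA iXA) _.
  rewrite -[A]setTI -Rintegral_indicM; apply: le_Rintegral => //.
  - apply: (@integrable_EFinMb _ _ _ _ _ _ _ 1) => //.
      by move=> w _; rewrite indicE; case: (_ \in _); rewrite ?normr0 ?normr1.
    by apply: integrable_norm; exact: iX.
  - by apply: integrable_norm; exact: iX.
  - by move=> w _; rewrite indicE; case: (_ \in _); rewrite ?mul0r ?mul1r.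
have bnd t : t \in `[0, T] -> 
    (\int[P]_w (X t w ^+ 2)%:E <= ((e / 4) ^+ 2)%:E)%E ->
    `|\int[P]_(w in A) X t w| <= e / 2.
  move=> tT Xe; apply: le_trans (XA t tT) _.
  have mX := integrable_EFin_measurable (iX t tT).
  by have := Rintegral_norm_le_of_sqr e4 mX Xe; lra.
have iA (Y : Omega -> R) : P.-integrable setT (EFin \o Y) -> P.-integrable A (EFin \o Y).
  exact: integrableS.
have -> : \int[P]_(w in A) (I T w - I r w) =
    \int[P]_(w in A) X r w - \int[P]_(w in A) X T w.
  rewrite -[LHS]subr0 -(si_integral_martingale (hv n) rT FA) -!RintegralB//.
  - transitivity (- - \int[P]_(w in A) (I T w - I r w - 
      (si_integral B (h n) T w - si_integral B (h n) r w))); first by rewrite opprK.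
    by rewrite opprK; apply: eq_Rintegral => w _; rewrite /X; ring.
  - by apply: iA; exact: iX.
  - by apply: iA; exact: iX.
  - by apply: iA; apply: integrable_EFinB => //; exact: ito_integral_integrable.
  - by apply: iA; apply: integrable_EFinB => //; exact: iS.
by apply: le_trans (ler_normB _ _) _; have := bnd r rT hr; have := bnd T TT hT; lra.
Unshelve. all: by end_near. Qed.

End ito.

(** * Joint measurability of processes *)

Section enorm.
Context (R : realType) (d : nat).
Implicit Types z : 'rV[R]_d.

Lemma enorm_ge0 z : 0 <= enorm z.
Proof. exact: sqrtr_ge0. Qed.

Lemma enorm0 : enorm (0 : 'rV[R]_d) = 0.
Proof. by rewrite /enorm big1 ?sqrtr0// => j _; rewrite mxE expr0n. Qed.

Lemma enorm_sqr z : enorm z ^+ 2 = \sum_(j < d) z 0 j ^+ 2.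
Proof. by rewrite sqr_sqrtr// sumr_ge0// => j _; exact: sqr_ge0. Qed.

Lemma enorm_le_sum z : enorm z <= \sum_(j < d) `|z 0 j|.
Proof.
have s0 : 0 <= \sum_(j < d) `|z 0 j| by rewrite sumr_ge0.
rewrite -ler_sqr ?nnegrE ?enorm_ge0// enorm_sqr.
rewrite expr2 mulr_suml; apply: ler_sum => j _.
rewrite -(real_normK (num_real (z 0 j))) expr2 ler_wpM2l//.
by rewrite (bigD1 j)//= lerDl sumr_ge0.
Qed.

Lemma coord_le_enorm z j : `|z 0 j| <= enorm z.
Proof.
rewrite -ler_sqr ?nnegrE ?enorm_ge0// enorm_sqr real_normK ?num_real//.
by rewrite (bigD1 j)//= lerDl sumr_ge0// => i _; exact: sqr_ge0.
Qed.

End enorm.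

Lemma lipschitz_continuous (R : realType) (g : R -> R) (c x : R) :
  (forall y, `|g x - g y| <= c * `|x - y|) -> {for x, continuous g}.
Proof.
move=> lip; apply/cvgrPdist_le => e e0.
have c0 : 0 < `|c| + 1 by rewrite ltr_wpDl.
near=> y; apply: (le_trans (lip y)).
apply: (@le_trans _ _ ((`|c| + 1) * `|x - y|)).
  by rewrite ler_wpM2r// (le_trans (ler_norm _))// lerDl.
rewrite -ler_pdivlMl//; near: y.
by apply: cvgr_dist_le; [exact: cvg_id | rewrite mulr_gt0// invr_gt0].
Unshelve. all: by end_near. Qed.

(** * Substituting a measurable argument into a Caratheodory function *)

Section caratheodory.
Import HBSimple.
Context (dd : measure_display) (S : measurableType dd) (R : realType).
Context (D : set S) (mD : measurable D).

(** When [h] is replaced by a simple function, preimages split into finitely many pieces on which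
    the argument is constant. Continuity in the argument then allows a pointwise limit along simple
    functions tending to [h]. *)
Lemma measurable_caratheodory (g : S -> R -> R) (h : S -> R) :
  (forall x, measurable_fun D (fun p => g p x)) ->
  (forall p, D p -> {for h p, continuous (g p)}) ->
  measurable_fun D h -> measurable_fun D (fun p => g p (h p)).
Proof.
move=> mg cg /measurable_EFinP mh.
have [phi phih] := approximation_sfun mD mh.
apply: (@measurable_fun_cvg _ _ _ D (fun n p => g p (phi n p))).
  move=> n _ C mC.
  rewrite (_ : _ `&` _ = \bigcup_(v in range (phi n))
      ((D `&` (fun p => g p v) @^-1` C) `&` (phi n @^-1` [set v]))).
    apply: fin_bigcup_measurable; first exact: fimfunP.
    by move=> v _; apply: measurableI; [exact: mg | exact: measurable_sfunP].
  apply/seteqP; split => p /=; first by move=> [Dp Cp]; exists (phi n p).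
  by move=> [v _ [[Dp Cp] ->]].
move=> p Dp; have /fine_cvgP[_ cvgphi] := phih p Dp.
exact: continuous_cvg (cg p Dp) cvgphi.
Qed.

Lemma measurable_caratheodory_vector d (g : S -> 'rV[R]_d -> R)
    (h : S -> 'rV[R]_d) (c : R) :
  (forall z, measurable_fun D (fun p => g p z)) ->
  (forall p, D p -> forall z z', `|g p z - g p z'| <= c * enorm (z - z')) ->
  (forall j, measurable_fun D (fun p => h p 0 j)) ->
  measurable_fun D (fun p => g p (h p)).
Proof.
move=> mg lipg mh.
(* The coordinates of the argument are made variable one at a time. *)
pose mix k p (z : 'rV[R]_d) := \row_(j < d) if (j < k)%N then h p 0 j else z 0 j.
suff mmix k : (k <= d)%N -> forall z, measurable_fun D (fun p => g p (mix k p z)).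
  apply: eq_measurable_fun (mmix d (leqnn d) 0) => p _.
  by congr (g p _); apply/rowP => j; rewrite mxE ltn_ord.
elim: k => [_ z|k IH kd z].
  apply: eq_measurable_fun (mg z) => p _.
  by congr (g p _); apply/rowP => j; rewrite mxE.
(* Coordinate [k] becomes a real parameter: for fixed [x] the induction hypothesis applies to
   [upd x], and in [x] the Lipschitz bound gives continuity. *)
pose upd (x : R) := \row_(j < d) if j == k :> nat then x else z 0 j.
pose j0 := Ordinal kd.
have cont p : D p -> {for h p 0 j0, continuous (fun x => g p (mix k p (upd x)))}.
  move=> Dp; apply: (@lipschitz_continuous _ _ c) => y.
  apply: le_trans (lipg p Dp _ _) _; rewrite le_eqVlt; apply/orP; left; apply/eqP.
  congr (_ * _); rewrite /enorm (bigD1 j0)//= !mxE/= ltnn eqxx big1 ?addr0 ?sqrtr_sqr//.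
  move=> j jj0; rewrite !mxE; case: ifP => _; first by rewrite subrr expr0n.
  by rewrite (negbTE (jj0 : (j : nat) != k)) subrr expr0n.
have := measurable_caratheodory (fun x => IH (ltnW kd) (upd x)) cont (mh j0).
apply: eq_measurable_fun => p _; congr (g p _); apply/rowP => j; rewrite !mxE.
rewrite [in RHS]ltnS [in RHS]leq_eqVlt.
case: (eqVneq (j : nat) k) => jk //=.
by rewrite jk ltnn/=; congr (h p 0 _); exact: val_inj.
Qed.

End caratheodory.

Section joint.
Context (dd : measure_display) (Omega : measurableType dd) (R : realType).
Context (T : R) (F : R -> set (set Omega)) (filF : filtration T F).
Hypothesis T_gt0 : 0 < T.
Implicit Types X : R -> Omega -> R.

Definition time_set : set (measurableTypeR R * Omega) := `[0, T] `*` setT.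

Definition jointly_measurable X :=
  measurable_fun time_set (fun p => X p.1 p.2).

Lemma measurable_time_set : measurable time_set.
Proof. by apply: measurableX => //; exact: measurable_itv. Qed.

Let TT : T \in `[0, T]. Proof. by rewrite in_itv/= lexx ltW. Qed.

(** Progressivity at the final time suffices, since the identity is measurable onto the coarser
    space carrying [F T]. *)
Lemma progressive_jointly_measurable X : progressive T F X -> jointly_measurable X.
Proof.
move=> /(_ T TT) pX.
pose c (p : measurableTypeR R * Omega) : R * g_sigma_algebraType (F T) := (p.1, p.2).
have mc : measurable_fun setT c.
  apply: measurable_fun_pair; first exact: measurable_fst.
  have mid := coarsen_measurable (filtration_sigma filF TT)
    (filtration_measurable filF TT).
  exact: (measurableT_comp mid measurable_snd).
have mD : measurable (`[0, T] `*` setT : set (R * g_sigma_algebraType (F T))).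
  by apply: measurableX => //; exact: measurable_itv.
have := measurable_comp mD _ pX (measurable_funS measurableT (@subsetT _ time_set) mc).
by apply => _ [p [? ?] <-]; split.
Qed.

Lemma predictable_jointly_measurable X : predictable T F X -> jointly_measurable X.
Proof.
move=> pX _ C mC; have := pX C mC; set E := _ `&` _.
apply: (@smallest_sub _ (sigma_algebra time_set) (predictable_rects T F) measurable).
  split => //.
  - by move=> A mA; apply: measurableD => //; exact: measurable_time_set.
  - by move=> A mA; exact: bigcup_measurable.
have F0 t A : 0 <= t -> t <= T -> F t A -> measurable A.
  by move=> t0 tT; apply: (filtration_measurable filF); rewrite in_itv/= t0 tT.
move=> A [[A' FA ->]|[s [t [A' [s0 st tT FA ->]]]]].
  by apply: measurableX; [exact: measurable_set1 | apply: (F0 0) => //; exact: ltW].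
apply: measurableX; first exact: measurable_itv.
by apply: (F0 s) => //; exact: le_trans tT.
Qed.

(** The process is a Caratheodory function of the outcome and of time, into which the time
    coordinate is substituted. *)
Lemma continuous_jointly_measurable X : adapted T F X -> continuous_process T X ->
  jointly_measurable X.
Proof.
move=> aX cX.
(* Paths are continuous only within [0, T]; precomposing with the projection onto this interval
   gives functions continuous on the whole line. *)
pose clamp (x : R) := Num.max 0 (Num.min x T).
have clampT x : clamp x \in `[0, T].
  by rewrite in_itv/= le_max lexx/= ge_max ge_min lexx orbT (ltW T_gt0).
have clampE x : x \in `[0, T] -> clamp x = x.
  by rewrite in_itv/= => /andP[x0 xT]; rewrite /clamp (min_idPl xT) (max_idPr x0).
have mD := measurable_time_set.
have := @measurable_caratheodory _ _ R time_set mD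
  (fun p x => X (clamp x) p.2) (fun p => p.1).
move=> H; have : measurable_fun time_set (fun p => X (clamp p.1) p.2).
  apply: H.
  - move=> x; apply: measurable_funTS.
    apply: (measurableT_comp _ measurable_snd).
    by apply: (filtration_sub_measurable filF (clampT x)); exact: aX.
  - move=> p _.
    have cXw := (@subspace_continuousP _ _ _ _).1 (cX p.2) _ (clampT p.1).
    have cc : {for p.1, continuous clamp}.
      apply: (@lipschitz_continuous _ _ 1) => y; rewrite mul1r /clamp.
      case: (leP y T) => ?; case: (leP p.1 T) => ?; case: (leP 0 y) => ?;
      case: (leP 0 p.1) => ?; case: (leP 0 T) => ?; rewrite ler_norml;
      case: (ger0P (p.1 - y)) => ?; apply/andP; split; lra.
    move=> U /cXw; rewrite /within/= nbhs_simpl => HU.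
    have := cc _ HU; rewrite !nbhs_simpl /=.
    by apply: filterS => y /(_ (clampT y)).
  - by apply: measurable_funTS; exact: measurable_fst.
apply: eq_measurable_fun => p; rewrite inE => -[/= pT _].
by rewrite clampE.
Qed.

End joint.

(** * Fubini on rectangles *)

Section integral_facts.
Context (dd : measure_display) (S : measurableType dd) (R : realType).
Context (mu : measure S R).

Import HBNNSimple.

(** The integral of a nonnegative function is a supremum over the simple functions below it, so it
    is monotone without measurability. This matters for the supremum over all times in [S2] and for
    inner integrals. *)
Lemma ge0_le_integral_nonmeasurable (D : set S) (f g : S -> \bar R) :
  (forall x, D x -> 0 <= f x)%E -> (forall x, D x -> f x <= g x)%E ->
  (\int[mu]_(x in D) f x <= \int[mu]_(x in D) g x)%E.
Proof.
move=> f0 fg; rewrite integral_mkcond [leRHS]integral_mkcond.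
have p0 x : (0 <= (f \_ D) x)%E.
  by rewrite patchE; case: ifPn => // /set_mem/f0.
have pfg x : ((f \_ D) x <= (g \_ D) x)%E.
  by rewrite !patchE; case: ifPn => // /set_mem/fg.
rewrite !ge0_integralTE//; last by move=> x; exact: le_trans (p0 x) (pfg x).
apply: ereal_sup_le => _ [h /= hf <-]; exists h => // x.
exact: le_trans (hf x) (pfg x).
Qed.

Lemma integrable_fine (D : set S) (f : S -> \bar R) : measurable D ->
  mu.-integrable D f -> mu.-integrable D (EFin \o (fun x => fine (f x))).
Proof.
move=> mD intf; have mf := measurable_int mu intf.
apply: le_integrable intf => //.
  apply/measurable_EFinP; apply: (measurableT_comp _ mf); exact: fine_measurable.
by move=> x _ /=; case: (f x) => [r| |]//=; rewrite normr0 leey.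
Qed.

Lemma Rintegral_fine (D : set S) (f : S -> \bar R) : measurable D ->
  mu.-integrable D f -> \int[mu]_(x in D) fine (f x) = fine (\int[mu]_(x in D) f x).
Proof.
move=> mD intf; rewrite /Rintegral; congr fine.
apply: ae_eq_integral => //.
- exact: (measurable_int mu (integrable_fine mD intf)).
- exact: (measurable_int mu intf).
- apply: filterS (integrable_ae mD intf) => x fin Dx.
  by rewrite fineK//; exact: fin.
Qed.

End integral_facts.

Lemma integrable_fubini_G d1 d2 (T1 : measurableType d1) (T2 : measurableType d2)
    (R : realType) (m1 : {sigma_finite_measure set T1 -> \bar R})
    (m2 : {sigma_finite_measure set T2 -> \bar R}) (f : T1 * T2 -> \bar R) :
  (m1 \x m2)%E.-integrable setT f -> m2.-integrable setT (fubini_G m1 f).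
Proof.
move=> intf; have mf := measurable_int _ intf.
have mabsf : measurable_fun setT (abse \o f) by exact: measurableT_comp.
have mG := measurable_fubini_G intf.
apply/integrableP; split => //.
apply: le_lt_trans ((integrable21ltyP m1 m2 mf).1 intf).
apply: ge0_le_integral => //.
- exact: measurableT_comp.
- by apply: (@measurable_fun_fubini_tonelli_G _ _ _ _ _ m1 _ mabsf) => p; exact: abse_ge0.
- move=> y _; apply: le_abse_integral => //.
  exact: measurable_fun_pair1.
Qed.

Section rectangle_fubini.
Context d1 d2 (T1 : measurableType d1) (T2 : measurableType d2) (R : realType).
Variables (m1 : {sigma_finite_measure set T1 -> \bar R}).
Variables (m2 : {sigma_finite_measure set T2 -> \bar R}).
Variables (D1 : set T1) (D2 : set T2) (mD1 : measurable D1) (mD2 : measurable D2).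
Implicit Types f : T1 -> T2 -> R.

Let mD : measurable (D1 `*` D2). Proof. exact: measurableX. Qed.

Let unc f (p : T1 * T2) : \bar R := (f p.1 p.2)%:E.

(** Extension by zero off the rectangle commutes with taking sections; this is how the Fubini
    theorems on the full product are brought to rectangles. *)
Let patch1 (g : T1 -> T2 -> \bar R) x :
  (fun y => ((fun p => g p.1 p.2) \_ (D1 `*` D2)) (x, y)) =
  if x \in D1 then (g x) \_ D2 else cst 0%E.
Proof.
apply/funext => y; rewrite !patchE /=; have [xD|xD] := boolP (x \in D1).
  rewrite patchE; have [yD|yD] := boolP (y \in D2).
    by rewrite mem_set//; split; exact: set_mem.
  by rewrite memNset// => -[_ /= /mem_set]; rewrite (negbTE yD).
by rewrite memNset// => -[/= /mem_set]; rewrite (negbTE xD).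
Qed.

Let patch2 (g : T1 -> T2 -> \bar R) y :
  (fun x => ((fun p => g p.1 p.2) \_ (D1 `*` D2)) (x, y)) =
  if y \in D2 then (fun x => g x y) \_ D1 else cst 0%E.
Proof.
apply/funext => x; rewrite !patchE /=; have [yD|yD] := boolP (y \in D2).
  rewrite patchE; have [xD|xD] := boolP (x \in D1).
    by rewrite mem_set//; split; exact: set_mem.
  by rewrite memNset// => -[/= /mem_set]; rewrite (negbTE xD).
by rewrite memNset// => -[_ /= /mem_set]; rewrite (negbTE yD).
Qed.

Let int1 (g : T1 -> T2 -> \bar R) :
  (fun x => \int[m2]_y ((fun p => g p.1 p.2) \_ (D1 `*` D2)) (x, y))%E =
  (fun x => \int[m2]_(y in D2) g x y)%E \_ D1.
Proof.
apply/funext => x; rewrite patch1 patchE; case: ifP => _.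
  by rewrite [RHS]integral_mkcond.
exact: integral0.
Qed.

Let int2 (g : T1 -> T2 -> \bar R) :
  (fun y => \int[m1]_x ((fun p => g p.1 p.2) \_ (D1 `*` D2)) (x, y))%E =
  (fun y => \int[m1]_(x in D1) g x y)%E \_ D2.
Proof.
apply/funext => y; rewrite patch2 patchE; case: ifP => _.
  by rewrite [RHS]integral_mkcond.
exact: integral0.
Qed.

Section tonelli.
Variable f : T1 -> T2 -> R.
Hypothesis mf : measurable_fun (D1 `*` D2) (fun p => f p.1 p.2).

Let mpatch : measurable_fun setT ((unc f) \_ (D1 `*` D2)).
Proof. by apply/(measurable_restrictT _ mD)/measurable_EFinP. Qed.

Let abs_patch : (fun p => `|((unc f) \_ (D1 `*` D2)) p|%E) =
  (fun p => `|f p.1 p.2|%:E) \_ (D1 `*` D2).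
Proof. by apply/funext => p; rewrite !patchE; case: ifP => //=; rewrite normr0. Qed.

Lemma integrable_rect12P : (m1 \x m2)%E.-integrable (D1 `*` D2) (unc f) <->
  (\int[m1]_(x in D1) \int[m2]_(y in D2) `|f x y|%:E < +oo)%E.
Proof.
rewrite (integrable_mkcond (unc f) mD) (integrable12ltyP m1 m2 mpatch).
rewrite [X in _ <-> (X < _)%E]integral_mkcond -(int1 (fun x y => `|f x y|%:E)).
by rewrite -abs_patch.
Qed.

Lemma integrable_rect21P : (m1 \x m2)%E.-integrable (D1 `*` D2) (unc f) <->
  (\int[m2]_(y in D2) \int[m1]_(x in D1) `|f x y|%:E < +oo)%E.
Proof.
rewrite (integrable_mkcond (unc f) mD) (integrable21ltyP m1 m2 mpatch).
rewrite [X in _ <-> (X < _)%E]integral_mkcond -(int2 (fun x y => `|f x y|%:E)).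
by rewrite -abs_patch.
Qed.

Lemma rect_measurable_tonelli1 :
  measurable_fun D1 (fun x => \int[m2]_(y in D2) `|f x y|%:E)%E.
Proof.
apply/(measurable_restrictT _ mD1); rewrite -(int1 (fun x y => `|f x y|%:E)).
have mabs : measurable_fun setT ((fun p => `|f p.1 p.2|%:E) \_ (D1 `*` D2)).
  by rewrite -abs_patch; exact: measurableT_comp mpatch.
apply: (@measurable_fun_fubini_tonelli_F _ _ _ _ _ m2 _ mabs) => p.
by rewrite patchE; case: ifP.
Qed.

End tonelli.

Section fubini.
Variable f : T1 -> T2 -> R.
Hypothesis intf : (m1 \x m2)%E.-integrable (D1 `*` D2) (unc f).

Let ipatch : (m1 \x m2)%E.-integrable setT ((unc f) \_ (D1 `*` D2)).
Proof. exact/(integrable_mkcond (unc f) mD). Qed.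

Lemma rect_ae_integrable1 :
  {ae m1, forall x, D1 x -> m2.-integrable D2 (EFin \o f x)}.
Proof.
apply: filterS (ae_integrable1 ipatch) => x + Dx.
by rewrite (patch1 (fun x y => (f x y)%:E)) mem_set// => /(integrable_mkcond _ mD2).
Qed.

Let iF : m1.-integrable D1 (fun x => \int[m2]_(y in D2) (f x y)%:E)%E.
Proof.
apply/(integrable_mkcond _ mD1); have := integrable_fubini_F ipatch.
by rewrite /fubini_F (int1 (fun x y => (f x y)%:E)).
Qed.

Let iG : m2.-integrable D2 (fun y => \int[m1]_(x in D1) (f x y)%:E)%E.
Proof.
apply/(integrable_mkcond _ mD2); have := integrable_fubini_G ipatch.
by rewrite /fubini_G (int2 (fun x y => (f x y)%:E)).
Qed.

Lemma rect_integrable_Rintegral1 :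
  m1.-integrable D1 (EFin \o (fun x => \int[m2]_(y in D2) f x y)).
Proof. exact: integrable_fine mD1 iF. Qed.

Lemma rect_integrable_Rintegral2 :
  m2.-integrable D2 (EFin \o (fun y => \int[m1]_(x in D1) f x y)).
Proof. exact: integrable_fine mD2 iG. Qed.

Lemma rect_Fubini :
  \int[m1]_(x in D1) (\int[m2]_(y in D2) f x y) =
  \int[m2]_(y in D2) (\int[m1]_(x in D1) f x y).
Proof.
rewrite (Rintegral_fine mD1 iF) (Rintegral_fine mD2 iG); congr fine.
rewrite integral_mkcond [RHS]integral_mkcond.
rewrite -(int1 (fun x y => (f x y)%:E)) -(int2 (fun x y => (f x y)%:E)).
exact: Fubini ipatch.
Qed.

End fubini.
End rectangle_fubini.

(** * Conditional expectations and processes integrable for dt x dP *)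

Section Rintegral_ae.
Context (dd : measure_display) (S : measurableType dd) (R : realType).
Context (mu : measure S R).
Implicit Types f g : S -> R.

Lemma ae_eq_Rintegral (A : set S) f g : measurable A ->
  measurable_fun A f -> measurable_fun A g ->
  {ae mu, forall x, A x -> f x = g x} ->
  \int[mu]_(x in A) f x = \int[mu]_(x in A) g x.
Proof.
move=> mA mf mg fg; rewrite /Rintegral; congr fine.
apply: ae_eq_integral => //; [exact/measurable_EFinP..|].
by apply: filterS fg => x fg Ax; rewrite fg.
Qed.

(** Replacing [g] by the maximum of [f] and [g] turns the almost sure inequality into one valid
    everywhere and leaves the integral unchanged. *)
Lemma ae_le_Rintegral (A : set S) f g : measurable A ->
  mu.-integrable A (EFin \o f) -> mu.-integrable A (EFin \o g) ->
  {ae mu, forall x, A x -> f x <= g x} ->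
  \int[mu]_(x in A) f x <= \int[mu]_(x in A) g x.
Proof.
move=> mA intf intg fg.
have mf := integrable_EFin_measurable intf.
have mg := integrable_EFin_measurable intg.
have mx : measurable_fun A (fun x => Num.max (f x) (g x)) by exact: measurable_maxr.
have E : {ae mu, forall x, A x -> Num.max (f x) (g x) = g x}.
  by apply: filterS fg => x fg Ax; exact/max_idPr/fg.
rewrite -(ae_eq_Rintegral mA mx mg E); apply: le_Rintegral => //.
  have iN : mu.-integrable A (EFin \o (fun x => `|f x| + `|g x|)).
    by apply: integrable_EFinD => //; exact: integrable_norm.
  apply: (le_integrable mA _ _ iN).
    exact/measurable_EFinP.
  move=> x _; rewrite /= lee_fin [leRHS]ger0_norm ?addr_ge0//.
  by case: (leP (f x) (g x)) => _; rewrite ?lerDl ?lerDr.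
by move=> x _; rewrite le_max lexx.
Qed.

End Rintegral_ae.

Section condexp_facts.
Context (dd : measure_display) (Omega : measurableType dd) (R : realType).
Context (P : probability Omega R) (H : set (set Omega)).
Hypotheses (sH : sigma_algebra setT H) (Hm : H `<=` measurable).
Implicit Types X V : Omega -> R.

Lemma indic_norm_le1 (A : set Omega) w : `|\1_A w : R| <= 1.
Proof. by rewrite indicE; case: (_ \in _); rewrite ?normr0 ?normr1. Qed.

(** The sign of [V] is 2 times the indicator of {V >= 0}, minus 1, hence [H]-measurable. Integrated
    against it, [V] may be exchanged for [X], and a sign times [X] is at most [|X|]. *)
Lemma condexp_norm_le X V : is_condexp P H X V ->
  (\int[P]_w `|V w|%:E <= \int[P]_w `|X w|%:E)%E.
Proof.
move=> cV; have [iX iV mV _] := cV; have VX := condexp_Rintegral cV.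
pose A := [set w | 0 <= V w].
have HA : H A.
  have := (sub_measurableP sH V).1 mV `[0, +oo[%classic (measurable_itv _).
  by congr H; apply/seteqP; split => w /=; rewrite in_itv/= andbT.
have HT := sub_sigmaT sH.
have mA := Hm HA.
have sgn (X' : Omega -> R) : P.-integrable setT (EFin \o X') ->
    P.-integrable setT (EFin \o (fun w => 2 * (\1_A w * X' w) - X' w)) /\
    \int[P]_w (2 * (\1_A w * X' w) - X' w) = 2 * \int[P]_(w in A) X' w - \int[P]_w X' w.
  move=> iX'.
  have i1 : P.-integrable setT (EFin \o (fun w => \1_A w * X' w)).
    apply: (@integrable_EFinMb _ _ _ _ _ _ _ 1) => //.
    by move=> w _; exact: indic_norm_le1.
  have i2 := integrable_EFinZ 2 measurableT i1.
  split; first exact: integrable_EFinB.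
  by rewrite RintegralB// RintegralZl// Rintegral_indicM setTI.
have finE (X' : Omega -> R) : P.-integrable setT (EFin \o X') ->
    (\int[P]_w `|X' w|%:E = (\int[P]_w `|X' w|)%:E)%E.
  move=> /(@integrable_norm _ _ _ P) iX'; rewrite /Rintegral fineK//.
  exact: integrable_fin_num iX'.
rewrite !finE// lee_fin.
have -> : \int[P]_w `|V w| = \int[P]_w (2 * (\1_A w * V w) - V w).
  apply: eq_Rintegral => w _; rewrite indicE.
  have [V0|V0] := leP 0 (V w).
    by rewrite ger0_norm// mem_set//= mul1r; ring.
  by rewrite ltr0_norm// memNset ?mul0r/=; [ring|rewrite /A/= leNgt V0].
rewrite (sgn V iV).2 !VX// -(sgn X iX).2.
apply: le_Rintegral => //; [exact: (sgn X iX).1|exact: integrable_norm|].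
move=> w _; rewrite indicE; case: (_ \in _) => /=.
  by rewrite mul1r (le_trans _ (ler_norm _))// (_ : _ - _ = X w)//; ring.
by rewrite mul0r mulr0 sub0r -normrN ler_norm.
Qed.

Lemma condexpB X X' V V' : is_condexp P H X V -> is_condexp P H X' V' ->
  is_condexp P H (fun w => X w - X' w) (fun w => V w - V' w).
Proof.
move=> cX cX'; have [iX iV mV _] := cX; have [iX' iV' mV' _] := cX'.
split; [exact: integrable_EFinB|exact: integrable_EFinB|exact: measurable_funB|].
move=> A HA; have mA := Hm HA.
have iA Z : P.-integrable setT (EFin \o Z) -> P.-integrable A (EFin \o Z).
  exact: integrableS.
rewrite -[LHS]fineK -1?[RHS]fineK.
- congr EFin; rewrite -!/(Rintegral _ _ _) !RintegralB//; [|exact: iA..].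
  by rewrite (condexp_Rintegral cX)// (condexp_Rintegral cX').
- by apply: (integrable_fin_num mA); apply: iA; exact: integrable_EFinB.
- by apply: (integrable_fin_num mA); apply: iA; exact: integrable_EFinB.
Qed.

Lemma condexp_ae_eq X X' V : P.-integrable setT (EFin \o X') ->
  {ae P, forall w, X w = X' w} -> is_condexp P H X V -> is_condexp P H X' V.
Proof.
move=> iX' XX' [iX iV mV VX]; split => // A HA; rewrite VX//.
apply: ae_eq_integral.
- exact: Hm.
- by apply: measurable_funTS; exact: (measurable_int _ iX).
- by apply: measurable_funTS; exact: (measurable_int _ iX').
- by apply: filterS XX' => w /= -> _.
Qed.

(** [condexp_le] speaks of arbitrary versions, so it gives information only once versions are known
    to exist. Two sigma-algebras are allowed so that the values at G_t and G_T can be compared on an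
    event common to both. *)
Lemma condexp_le_Rintegral (H' : set (set Omega)) X X' A :
  sigma_algebra setT H' -> H' `<=` measurable ->
  P.-integrable setT (EFin \o X) -> P.-integrable setT (EFin \o X') ->
  condexp_le P H X H' X' -> H A -> H' A ->
  \int[P]_(w in A) X w <= \int[P]_(w in A) X' w.
Proof.
move=> sH' Hm' iX iX' le HA HA'.
have [V cV] := condexp_exists sH Hm iX.
have [V' cV'] := condexp_exists sH' Hm' iX'.
rewrite -(condexp_Rintegral cV HA) -(condexp_Rintegral cV' HA').
have mA := Hm HA; have [_ iV _ _] := cV; have [_ iV' _ _] := cV'.
apply: ae_le_Rintegral => //; [exact: integrableS iV|exact: integrableS iV'|].
by apply: filterS (le _ _ cV cV') => w.
Qed.

End condexp_facts.

(** * Processes integrable for the product of Lebesgue measure and P *)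

Section time_space.
Context (dd : measure_display) (Omega : measurableType dd) (R : realType).
Context (P : probability Omega R) (T : R).
Hypothesis T_gt0 : 0 < T.
Implicit Types X Y : R -> Omega -> R.
Notation leb := (@lebesgue_measure R).

Definition dtdP_integrable X :=
  (leb \x P)%E.-integrable (@time_set _ Omega R T) (fun p => (X p.1 p.2)%:E).

Let mI : measurable (`[0, T]%classic : set (measurableTypeR R)).
Proof. exact: measurable_itv. Qed.

Let mD := @measurable_time_set _ Omega R T.

Lemma dtdP_integrable_le X Y : jointly_measurable T X -> dtdP_integrable Y ->
  (forall s w, s \in `[0, T] -> `|X s w| <= Y s w) -> dtdP_integrable X.
Proof.
move=> mX iY XY; apply: le_integrable iY => //; first exact/measurable_EFinP.
move=> p [/= pT _]; rewrite lee_fin (le_trans (XY _ _ pT))//.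
exact: ler_norm.
Qed.

Lemma dtdP_integrableD X Y : dtdP_integrable X -> dtdP_integrable Y ->
  dtdP_integrable (fun s w => X s w + Y s w).
Proof. exact: integrable_EFinD. Qed.

Lemma dtdP_integrableB X Y : dtdP_integrable X -> dtdP_integrable Y ->
  dtdP_integrable (fun s w => X s w - Y s w).
Proof. exact: integrable_EFinB. Qed.

Lemma dtdP_integrableZ c X : dtdP_integrable X ->
  dtdP_integrable (fun s w => c * X s w).
Proof. exact: integrable_EFinZ. Qed.

Lemma dtdP_integrable_sum (I : Type) (r : seq I) (X : I -> R -> Omega -> R) :
  (forall i, dtdP_integrable (X i)) ->
  dtdP_integrable (fun s w => \sum_(i <- r) X i s w).
Proof. by move=> iX; apply: integrable_EFin_sum => // i; exact: iX. Qed.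

Lemma dtdP_integrable_norm X : dtdP_integrable X ->
  dtdP_integrable (fun s w => `|X s w|).
Proof. exact: integrable_norm. Qed.

(** Made for conditional expectations, which are dominated in L^1 at almost every time but not
    pointwise. *)
Lemma dtdP_integrable_ae_le X Y : jointly_measurable T X -> dtdP_integrable Y ->
  {ae leb, forall s, s \in `[0, T] ->
    (\int[P]_w `|X s w|%:E <= \int[P]_w `|Y s w|%:E)%E} ->
  dtdP_integrable X.
Proof.
move=> mX iY XY; apply/(integrable_rect12P leb P mI measurableT mX).
have mY : jointly_measurable T Y by exact: integrable_EFin_measurable iY.
apply: le_lt_trans ((integrable_rect12P leb P mI measurableT mY).1 iY).
apply: ae_ge0_le_integral => //.
- by move=> s _; exact: integral_ge0.
- exact: (rect_measurable_tonelli1 P mI measurableT mX).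
- by move=> s _; exact: integral_ge0.
- exact: (rect_measurable_tonelli1 P mI measurableT mY).
Qed.

Lemma dtdP_integrable_bounded X (M : R) : jointly_measurable T X ->
  (forall s, s \in `[0, T] -> (\int[P]_w `|X s w|%:E <= M%:E)%E) ->
  dtdP_integrable X.
Proof.
move=> mX XM; apply/(integrable_rect12P leb P mI measurableT mX).
apply: (@le_lt_trans _ _ (\int[leb]_(s in `[0%R, T]) M%:E)%E).
  have M0 : (0 <= M%:E)%E.
    by apply: le_trans (XM 0 _); [exact: integral_ge0 | rewrite in_itv/= lexx ltW].
  apply: ge0_le_integral => //.
  - by move=> s _; exact: integral_ge0.
  - exact: (rect_measurable_tonelli1 P mI measurableT mX).
rewrite integral_cst//= lebesgue_measure_itv/= lte_fin T_gt0.
by rewrite -EFinB -EFinM ltry.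
Qed.

Lemma dtdP_integrable_cst c : dtdP_integrable (fun _ _ => c).
Proof.
apply: (@dtdP_integrable_bounded _ `|c|); first exact: measurable_cst.
move=> s _; rewrite integral_cst//= -[leRHS]mule1 lee_pmul//.
exact: probability_le1.
Qed.

Lemma dtdP_integrable_sqr X : jointly_measurable T X ->
  (\int[P]_w \int[leb]_(t in `[0%R, T]) ((X t w) ^+ 2)%:E < +oo)%E ->
  dtdP_integrable X.
Proof.
move=> mX X2.
have i2 : dtdP_integrable (fun s w => X s w ^+ 2).
  have mX2 : jointly_measurable T (fun s w => X s w ^+ 2) by exact: measurable_funX.
  apply/(integrable_rect21P leb P mI measurableT mX2).
  apply: le_lt_trans X2; rewrite le_eqVlt; apply/orP; left; apply/eqP.
  apply: eq_integral => w _; apply: eq_integral => s _.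
  by rewrite ger0_norm// sqr_ge0.
apply: dtdP_integrable_le mX (dtdP_integrableD (dtdP_integrable_cst 1) i2) _.
move=> s w _; rewrite -(real_normK (num_real (X s w))).
have := normr_ge0 (X s w); have : 0 <= (`|X s w| - 1) ^+ 2 by exact: sqr_ge0.
by nra.
Qed.

Section sections.
Variables (X : R -> Omega -> R) (iX : dtdP_integrable X).

Lemma dtdP_ae_integrable :
  {ae leb, forall s, s \in `[0, T] -> P.-integrable setT (EFin \o X s)}.
Proof. exact: (rect_ae_integrable1 mI measurableT (f := X) iX). Qed.

Variables (t : R) (A : set Omega).
Hypotheses (tT : t \in `[0, T]) (mA : measurable A).

Let mIt : measurable (`[t, T]%classic : set (measurableTypeR R)).
Proof. exact: measurable_itv. Qed.

Let iXt : (leb \x P)%E.-integrable (`[t, T]%classic `*` A) (fun p => (X p.1 p.2)%:E).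
Proof.
apply: integrableS iX => //; first exact: measurableX.
move=> [s w] [/= st _]; split => //=; move: tT st; rewrite !in_itv/= => /andP[t0 _].
by move=> /andP[ts ->]; rewrite (le_trans t0).
Qed.

Lemma dtdP_integrable_time :
  leb.-integrable `[t, T] (EFin \o (fun s => \int[P]_(w in A) X s w)).
Proof. exact: (rect_integrable_Rintegral1 mIt mA (f := X) iXt). Qed.

Lemma dtdP_integrable_space :
  P.-integrable A (EFin \o (fun w => \int[leb]_(s in `[t, T]) X s w)).
Proof. exact: (rect_integrable_Rintegral2 mIt mA (f := X) iXt). Qed.

Lemma dtdP_Fubini :
  \int[P]_(w in A) (\int[leb]_(s in `[t, T]) X s w) =
  \int[leb]_(s in `[t, T]) (\int[P]_(w in A) X s w).
Proof. by rewrite (rect_Fubini mIt mA (f := X) iXt). Qed.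

End sections.
End time_space.

(** * Expectations of a solution of the equation *)

Section bsde.
Context (dd : measure_display) (Omega : measurableType dd) (R : realType).
Context (P : probability Omega R) (T : R) (F G : R -> set (set Omega)).
Context (T_gt0 : 0 < T) (filF : filtration T F) (subG : subfiltration T G F).
Context (d : nat) (B : R -> Omega -> 'rV[R]_d).
Notation leb := (@lebesgue_measure R).
Notation dtdP := (dtdP_integrable P T).

Let filG : filtration T G. Proof. exact: subG.1. Qed.

Lemma dtdP_jointly_measurable X : dtdP X -> jointly_measurable T X.
Proof. exact: integrable_EFin_measurable. Qed.

(** From |x| <= 1 + x^2 and the bound of each Y_s^2 by the supremum over time; the bound is uniform
    in [s]. *)
Lemma S2_bounded Y : S2 P T F Y -> exists M : R, forall s, s \in `[0, T] ->
  P.-integrable setT (EFin \o Y s) /\ (\int[P]_w `|Y s w|%:E <= M%:E)%E.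
Proof.
move=> [aY cY]; set S := (\int[P]_w _)%E => Sfin.
have S0 : (0 <= S)%E.
  apply: integral_ge0 => w _; apply: ereal_sup_ge.
  exists (Y 0 w ^+ 2)%:E; last by rewrite lee_fin sqr_ge0.
  by exists 0 => //=; rewrite in_itv/= lexx ltW.
have Sfinum : S \is a fin_num by rewrite ge0_fin_numE.
exists (1 + fine S) => s sT.
have mY := filtration_sub_measurable filF sT (aY s sT).
have leS : (\int[P]_w (Y s w ^+ 2)%:E <= S)%E.
  apply: ge0_le_integral_nonmeasurable => w _; first by rewrite lee_fin sqr_ge0.
  by apply: ereal_sup_ubound; exists s.
have ltS := le_lt_trans leS Sfin.
split; first exact: (sqr_integrable mY ltS).
rewrite EFinD fineK//; apply: le_trans (leeD2l _ leS).
apply: (@le_trans _ _ (\int[P]_w (1%:E + (Y s w ^+ 2)%:E))%E).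
  apply: ge0_le_integral_nonmeasurable => w _; first by rewrite lee_fin.
  rewrite -EFinD lee_fin -(real_normK (num_real (Y s w))).
  have := normr_ge0 (Y s w); have : 0 <= (`|Y s w| - 1) ^+ 2 by exact: sqr_ge0.
  by nra.
rewrite ge0_integralD//.
- rewrite integral_cst//= mul1e; apply: leeD2r; exact: probability_le1.
- by move=> w _; rewrite lee_fin sqr_ge0.
- by apply/measurable_EFinP; exact: measurable_funX.
Qed.

Lemma S2_dtdP Y : S2 P T F Y -> dtdP Y.
Proof.
move=> Y2; have [M YM] := S2_bounded Y2; have [aY cY _] := Y2.
apply: (dtdP_integrable_bounded T_gt0 (M := M)).
  exact: (continuous_jointly_measurable filF T_gt0 aY cY).
by move=> s sT; exact: (YM s sT).2.
Qed.

Lemma H2_coord_dtdP (Z : R -> Omega -> 'rV[R]_d) j :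
  H2 P T F Z -> dtdP (fun s w => Z s w 0 j).
Proof.
move=> [pZ fin]; apply: (dtdP_integrable_sqr T_gt0).
  exact: (predictable_jointly_measurable filF T_gt0).
apply: le_lt_trans fin.
apply: ge0_le_integral_nonmeasurable => w _.
  by apply: integral_ge0 => s _; rewrite lee_fin sqr_ge0.
apply: ge0_le_integral_nonmeasurable => s _; first by rewrite lee_fin sqr_ge0.
rewrite lee_fin -(real_normK (num_real (Z s w 0 j))).
by rewrite ler_sqr ?nnegrE ?enorm_ge0// coord_le_enorm.
Qed.

Lemma condexp_process_dtdP X V : dtdP X -> condexp_process P T G X V -> dtdP V.
Proof.
move=> iX [pV cV]; apply: (dtdP_integrable_ae_le _ iX).
  exact: (progressive_jointly_measurable filG T_gt0).
have ae_iX := dtdP_ae_integrable iX.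
apply: (@filterS _ _ (ae_filter_ringOfSetsType leb) _ _ _ ae_iX) => s iXs sT.
have sG := filtration_sigma filG sT; have mG := filtration_measurable filG sT.
exact: (condexp_norm_le sG mG (cV s sT (iXs sT))).
Qed.

(** Measurability is obtained by substituting the four processes one after the other, each time with
    the Lipschitz bound in the new argument. Integrability follows from the linear growth that the
    same bound implies. *)
Lemma driver_dtdP (f : driver Omega R d) (Y : R -> Omega -> R)
    (Z : R -> Omega -> 'rV[R]_d) (Y' : R -> Omega -> R)
    (Z' : R -> Omega -> 'rV[R]_d) :
  standard_lipschitz_driver P T F f ->
  dtdP Y -> (forall j, dtdP (fun s w => Z s w 0 j)) ->
  dtdP Y' -> (forall j, dtdP (fun s w => Z' s w 0 j)) ->
  dtdP (fun s w => f s w (Y s w) (Z s w) (Y' s w) (Z' s w)).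
Proof.
move=> [pf [c c0 lip] f0] iY iZ iY' iZ'.
have mD := @measurable_time_set _ Omega R T.
have cst1 y z y' z' : jointly_measurable T (fun s w => f s w y z y' z').
  by apply: (progressive_jointly_measurable filF T_gt0); exact: pf.
have lipZ s w y y1 z z1 y' y1' z' z1' : s \in `[0, T] ->
  `|f s w y z y' z' - f s w y1 z1 y1' z1'| <=
  c * (`|y - y1| + enorm (z - z1) + `|y' - y1'| + enorm (z' - z1')).
  exact: lip.
have zero := (subrr, normr0, enorm0, addr0, add0r).
have m1 z y' z' : jointly_measurable T (fun s w => f s w (Y s w) z y' z').
  apply: (measurable_caratheodory mD (g := fun p y => f p.1 p.2 y z y' z')) => //.
  - by move=> y; exact: cst1.
  - move=> p [/= pT _]; apply: (@lipschitz_continuous _ _ c) => y.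
    by apply: (le_trans (lipZ _ _ _ _ _ _ _ _ _ _ pT)); rewrite !zero.
  - exact: dtdP_jointly_measurable.
have m2 y' z' : jointly_measurable T (fun s w => f s w (Y s w) (Z s w) y' z').
  apply: (measurable_caratheodory_vector mD (c := c)
    (g := fun p z => f p.1 p.2 (Y p.1 p.2) z y' z')).
  - by move=> z; exact: m1.
  - move=> p [/= pT _] z z1.
    by apply: (le_trans (lipZ _ _ _ _ _ _ _ _ _ _ pT)); rewrite !zero.
  - by move=> j; exact: (dtdP_jointly_measurable (iZ j)).
have m3 z' : jointly_measurable T (fun s w => f s w (Y s w) (Z s w) (Y' s w) z').
  apply: (measurable_caratheodory mD
    (g := fun p y' => f p.1 p.2 (Y p.1 p.2) (Z p.1 p.2) y' z')) => //.
  - by move=> y; exact: m2.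
  - move=> p [/= pT _]; apply: (@lipschitz_continuous _ _ c) => y.
    by apply: (le_trans (lipZ _ _ _ _ _ _ _ _ _ _ pT)); rewrite !zero.
  - exact: dtdP_jointly_measurable.
have m4 : jointly_measurable T (fun s w => f s w (Y s w) (Z s w) (Y' s w) (Z' s w)).
  apply: (measurable_caratheodory_vector mD (c := c)
    (g := fun p z => f p.1 p.2 (Y p.1 p.2) (Z p.1 p.2) (Y' p.1 p.2) z)).
  - by move=> z; exact: m3.
  - move=> p [/= pT _] z z1.
    by apply: (le_trans (lipZ _ _ _ _ _ _ _ _ _ _ pT)); rewrite !zero.
  - by move=> j; exact: (dtdP_jointly_measurable (iZ' j)).
have if0 : dtdP (fun s w => f s w 0 0 0 0) by exact: (dtdP_integrable_sqr T_gt0).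
have ibound : dtdP (fun s w => `|f s w 0 0 0 0| + c * (`|Y s w| +
    \sum_(j < d) `|Z s w 0 j| + `|Y' s w| + \sum_(j < d) `|Z' s w 0 j|)).
  apply: dtdP_integrableD; first exact: dtdP_integrable_norm.
  apply: dtdP_integrableZ; apply: dtdP_integrableD.
    apply: dtdP_integrableD; last exact: dtdP_integrable_norm.
    apply: dtdP_integrableD; first exact: dtdP_integrable_norm.
    by apply: dtdP_integrable_sum => j; apply: dtdP_integrable_norm; exact: iZ.
  by apply: dtdP_integrable_sum => j; apply: dtdP_integrable_norm; exact: iZ'.
apply: (dtdP_integrable_le m4 ibound) => s w sT.
rewrite -lerBlDl (le_trans (lerB_dist _ _))//.
apply: le_trans (lipZ _ _ _ _ _ _ _ _ _ _ sT) _; rewrite !subr0.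
by rewrite ler_pM2l// !lerD// enorm_le_sum.
Qed.

Section solution.
Hypothesis BM : brownian_motion P T F B.
Variables (f : driver Omega R d) (xi : Omega -> R) (K Y : R -> Omega -> R).
Variables (Z : R -> Omega -> 'rV[R]_d) (EY : R -> Omega -> R).
Variable EZ : R -> Omega -> 'rV[R]_d.
Hypotheses (f_std : standard_lipschitz_driver P T F f) (K_S2 : S2 P T F K).
Hypothesis sol : bsde_solution P T F G B f xi K Y Z EY EZ.

Lemma bsde_driver_dtdP : dtdP (fun s w => f s w (Y s w) (Z s w) (EY s w) (EZ s w)).
Proof.
have [Y2 Z2 cY cZ _] := sol; apply: driver_dtdP => //.
- exact: S2_dtdP.
- by move=> j; exact: H2_coord_dtdP.
- exact: condexp_process_dtdP (S2_dtdP Y2) cY.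
- by move=> j; exact: condexp_process_dtdP (H2_coord_dtdP j Z2) (cZ j).
Qed.

Let TT : T \in `[0, T]. Proof. by rewrite in_itv/= lexx ltW. Qed.

Lemma bsde_terminal : {ae P, forall w, Y T w = xi w}.
Proof.
have [_ _ _ _ [I _ /(_ T TT)]] := sol; apply: filterS => w ->.
by rewrite set_itv1 Rintegral_set1; ring.
Qed.

(** The equation tested on an event of [F t]: the stochastic integral drops out as a martingale
    increment, and Fubini moves the expectation inside the time integral. *)
Lemma bsde_Rintegral t A : t \in `[0, T] -> F t A ->
  \int[P]_(w in A) Y t w = \int[P]_(w in A) Y T w +
  \int[leb]_(s in `[t, T]) (\int[P]_(w in A) f s w (Y s w) (Z s w) (EY s w) (EZ s w)) +
  \int[P]_(w in A) (K T w - K t w).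
Proof.
move=> tT FA; have [Y2 _ _ _ [I itoI eqn]] := sol.
have mA := filtration_measurable filF tT FA.
have iphi := bsde_driver_dtdP.
rewrite -(dtdP_Fubini iphi tT mA).
set J := fun w => \int[leb]_(s in `[t, T]) _.
have iS (X : Omega -> R) : P.-integrable setT (EFin \o X) -> P.-integrable A (EFin \o X).
  exact: integrableS.
have iYA s : s \in `[0, T] -> P.-integrable A (EFin \o Y s).
  by move=> sT; have [M YM] := S2_bounded Y2; apply: iS; exact: (YM s sT).1.
have iKA s : s \in `[0, T] -> P.-integrable A (EFin \o K s).
  by move=> sT; have [M KM] := S2_bounded K_S2; apply: iS; exact: (KM s sT).1.
have iIA s : s \in `[0, T] -> P.-integrable A (EFin \o I s).
  by move=> sT; apply: iS; exact: (ito_integral_integrable filF BM itoI).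
have iJ : P.-integrable A (EFin \o J) by exact: (dtdP_integrable_space iphi tT mA).
have i1 : P.-integrable A (EFin \o (fun w => Y T w + J w)).
  by apply: integrable_EFinD => //; exact: iYA.
have iK : P.-integrable A (EFin \o (fun w => K T w - K t w)).
  by apply: integrable_EFinB => //; exact: iKA.
have iI : P.-integrable A (EFin \o (fun w => I T w - I t w)).
  by apply: integrable_EFinB => //; exact: iIA.
have i2 : P.-integrable A (EFin \o (fun w => Y T w + J w + (K T w - K t w))).
  exact: integrable_EFinD.
rewrite -RintegralD//; last exact: iYA.
rewrite -RintegralD// -[RHS]subr0.
(* The zero just subtracted is rewritten as the integral of [I T - I t] over [A], so that both sides
   are integrals of the two members of the equation. *)
rewrite -(ito_integral_martingale filF BM itoI tT FA) -RintegralB//.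
apply: ae_eq_Rintegral => //.
- exact: (integrable_EFin_measurable (iYA t tT)).
- exact: (integrable_EFin_measurable (integrable_EFinB mA i2 iI)).
- apply: filterS2 bsde_terminal (eqn t tT) => w YT Yt _.
  by rewrite {}Yt YT /J; ring.
Qed.

End solution.
End bsde.

(** * A backward Gronwall inequality *)

Section gronwall.
Context (R : realType) (T L C : R) (phi : R -> R).
Notation leb := (@lebesgue_measure R).
Hypotheses (L_gt0 : 0 < L) (phi_le : forall t, t \in `[0, T] -> phi t <= C).
Hypothesis phi_int : leb.-integrable `[0, T] (EFin \o phi).
Hypothesis phi_ineq : forall t, t \in `[0, T] ->
  phi t <= L * \int[leb]_(s in `[t, T]) phi s.

(** The step length for which L times delta is 1/2. *)
Let delta := (2 * L)^-1.

Let delta_gt0 : 0 < delta. Proof. by rewrite invr_gt0 mulr_gt0. Qed.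

(** Only times within [delta] of [t] can contribute positively, and they contribute at most
    [c * delta]; multiplying by [L] halves [c]. *)
Let integral_bound (c t : R) : 0 <= c -> t \in `[0, T] ->
  (forall s, s \in `[t, T] -> s <= t + delta -> phi s <= c) ->
  (forall s, s \in `[t, T] -> t + delta < s -> phi s <= 0) ->
  phi t <= c / 2.
Proof.
move=> c0 tT small big; apply: (le_trans (phi_ineq tT)).
pose J : set (measurableTypeR R) := `[t, T]%classic.
pose D : set (measurableTypeR R) := `[t, t + delta]%classic.
have mJ : measurable J by exact: measurable_itv.
have mD : measurable D by exact: measurable_itv.
have lebD : leb D = delta%:E.
  rewrite /D lebesgue_measure_itv/= lte_fin ltrDl delta_gt0 -EFinB.
  by congr EFin; ring.
have lebJD : (leb (J `&` D) <= delta%:E)%E.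
  by rewrite -lebD; apply: le_measure; rewrite ?inE//; exact: measurableI.
have lebfin : leb (J `&` D) \is a fin_num.
  by rewrite ge0_fin_numE// (le_lt_trans lebJD) ?ltry.
have lebJ : (leb J < +oo)%E.
  by rewrite /J lebesgue_measure_itv/=; case: ifP => _; rewrite -?EFinB ltry.
have iind : leb.-integrable J (EFin \o (fun s => \1_D s * c)).
  apply: (@integrable_EFinMb _ _ _ _ _ _ _ 1) => //.
    by move=> w _; exact: indic_norm_le1.
  apply: measurable_bounded_integrable => //.
  by exists `|c|; split => // x cx y _; exact: ltW.
have iphi : leb.-integrable J (EFin \o phi).
  apply: integrableS phi_int => //.
  move=> s; rewrite /J /=; move: tT; rewrite !in_itv/= => /andP[t0 _] /andP[ts ->].
  by rewrite (le_trans t0).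
have : \int[leb]_(s in J) phi s <= c * delta.
  apply: (@le_trans _ _ (\int[leb]_(s in J) (\1_D s * c))).
    apply: le_Rintegral => // s stT; rewrite indicE.
    have ts : t <= s by move: stT; rewrite /J/= in_itv/= => /andP[].
    have [h|h] := leP s (t + delta).
      by rewrite mem_set ?mul1r; [exact: small | rewrite /D/= in_itv/= ts h].
    rewrite memNset ?mul0r; first exact: big.
    by rewrite /D/= in_itv/= ts/= leNgt h.
  rewrite Rintegral_indicM Rintegral_cst; last exact: measurableI.
  by rewrite ler_wpM2l// -lee_fin fineK.
move=> le; apply: (@le_trans _ _ (L * (c * delta))); first by rewrite ler_pM2l.
by rewrite (_ : _ * _ = c / 2)// /delta; field; rewrite gt_eqF.
Qed.

(* Induction on the number of steps of length [1 / (2 L)] separating [t] from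
   [T]; over one step the bound can be halved indefinitely. *)
Lemma backward_gronwall t : t \in `[0, T] -> phi t <= 0.
Proof.
move=> tT; have [t0 t1] : 0 <= t /\ t <= T by move: tT; rewrite in_itv/= => /andP[].
have C0 : 0 <= `|C| by [].
have main n : forall s, s \in `[0, T] -> T < s + n%:R * delta -> phi s <= 0.
  elim: n => [s|n IHn s sT Ts].
    by rewrite in_itv/= mul0r addr0 => /andP[_ sT] /lt_le_trans/(_ sT); rewrite ltxx.
  have halve m : forall r, r \in `[0, T] -> T < r + n.+1%:R * delta ->
      phi r <= `|C| / 2 ^+ m.
    elim: m => [r rT _|m IHm r rT Tr].
      by rewrite expr0 divr1 (le_trans (phi_le rT))// ler_norm.
    have sub q : q \in `[r, T] -> q \in `[0, T] /\ r <= q.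
      move: rT; rewrite !in_itv/= => /andP[r0 _] /andP[rq ->].
      by rewrite rq (le_trans r0).
    (* Times within [delta] of [r] satisfy the previous bound [IHm]; later ones are within n steps
       of [T], where [IHn] already gives a nonpositive value. *)
    rewrite exprS invfM mulrCA mulrC; apply: integral_bound => //.
    - move=> q /sub[qT rq] _; apply: IHm => //.
      by rewrite (lt_le_trans Tr)// lerD2r.
    - move=> q /sub[qT rq] rdq; apply: IHn => //.
      by move: Tr; rewrite -natr1 mulrDl mul1r => Tr; lra.
  rewrite leNgt; apply/negP => phis.
  (* Then 2^m > m > |C| / phi(s), against the bound of [phi s] after m halvings. *)
  pose m := (Num.truncn (`|C| / phi s)).+1.
  have := halve m s sT Ts; rewrite ler_pdivlMr ?exprn_gt0// leNgt => /negP; apply.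
  rewrite -ltr_pdivrMl// mulrC (lt_trans (truncnS_gt _))// -/m.
  by rewrite -natrX ltr_nat ltn_expl.
pose n := (Num.truncn ((T - t) / delta)).+1.
apply: (main n t tT); rewrite -ltrBlDl -ltr_pdivrMr//.
exact: truncnS_gt.
Qed.

End gronwall.

(** * Comparison *)

Section linearised_drift.
Context (R : realType).

(** When x = y the Lipschitz bound forces p = q, so setting the quotient to 0 there preserves both
    the factorisation and the bound. *)
Lemma difference_quotientP (c p q x y : R) : 0 <= c -> `|p - q| <= c * `|x - y| ->
  (p - q) / (x - y) * (x != y)%:R * (x - y) = p - q /\
  `|(p - q) / (x - y) * (x != y)%:R| <= c.
Proof.
move=> c0; have [->|xy] := eqVneq x y.
  by rewrite subrr normr0 mulr0 normr_le0 => /eqP ->; rewrite !mulr0 normr0.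
have xy0 : x - y != 0 by rewrite subr_eq0.
move=> le; rewrite mulr1 divfK//; split => //.
by rewrite normf_div ler_pdivrMr ?normr_gt0.
Qed.

Context (dd : measure_display) (Omega : measurableType dd).
Context (P : probability Omega R) (H : set (set Omega)).
Hypotheses (sH : sigma_algebra setT H) (Hm : H `<=` measurable).

(* Only the coefficient of [y] has to be measurable with respect to [H]: this
   lets [y] be replaced by [u], and then only the sign of [a + b] matters. *)
Lemma linearised_drift_le (y u a b D : Omega -> R) (c : R) (A : set Omega) :
  P.-integrable setT (EFin \o y) -> P.-integrable setT (EFin \o D) ->
  is_condexp P H y u -> sub_measurable H a ->
  (forall w, `|a w| <= c) -> (forall w, `|b w| <= c) ->
  {ae P, forall w, 0 <= a w + b w} ->
  (forall w, D w = a w * y w + b w * u w) -> H A ->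
  \int[P]_(w in A) D w <= 2 * c * \int[P]_w Num.max (u w) 0.
Proof.
move=> iy iD cu ma ac bc ab0 DE HA.
have [_ iu mu _] := cu; have yu := condexp_Rintegral cu.
have mA := Hm HA.
have mA' := sub_measurable_measurable sH Hm ma.
have iA (X : Omega -> R) : P.-integrable setT (EFin \o X) -> P.-integrable A (EFin \o X).
  exact: integrableS.
have iay : P.-integrable setT (EFin \o (fun w => a w * y w)).
  by apply: (@integrable_EFinMb _ _ _ _ _ _ _ c).
have iau : P.-integrable setT (EFin \o (fun w => a w * u w)).
  by apply: (@integrable_EFinMb _ _ _ _ _ _ _ c).
(* This is [b * u] in disguise: its integrability is read off from those of [D] and [a * y]. *)
have ibu : P.-integrable setT (EFin \o (fun w => D w - a w * y w)).
  exact: integrable_EFinB.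
have iup : P.-integrable setT (EFin \o (fun w => Num.max (u w) 0)).
  apply: (le_integrable measurableT _ _ iu).
    apply/measurable_EFinP; apply: measurable_maxr => //.
    exact: (sub_measurable_measurable sH Hm mu).
  move=> w _; rewrite /= lee_fin; case: (leP (u w) 0) => h; last by [].
  by rewrite normr0.
have ayu : \int[P]_(w in A) (a w * y w) = \int[P]_(w in A) (a w * u w).
  apply/eqP; rewrite -subr_eq0 -RintegralB//; [|exact: iA..].
  apply/eqP; have iyu := integrable_EFinB measurableT iy iu.
  under eq_Rintegral do rewrite -mulrBr.
  apply: (Rintegral_sub_measurableM sH Hm iyu _ ma ac) => // C HC.
  have mC := Hm HC; rewrite RintegralB//; [|exact: integrableS iy|exact: integrableS iu].
  by rewrite yu// subrr.
have -> : \int[P]_(w in A) D w = \int[P]_(w in A) (a w * u w + (D w - a w * y w)).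
  rewrite RintegralD//; [|exact: iA..].
  rewrite -ayu -RintegralD//; [|exact: iA..].
  by apply: eq_Rintegral => w _; ring.
apply: (@le_trans _ _ (\int[P]_(w in A) (2 * c * Num.max (u w) 0))).
  apply: ae_le_Rintegral => //.
  - by apply: iA; exact: integrable_EFinD.
  - by apply: iA; exact: integrable_EFinZ.
  apply: filterS ab0 => w ab _; rewrite DE.
  rewrite (_ : _ + _ = (a w + b w) * u w); last by ring.
  (* For u <= 0 the sign of a + b gives a nonpositive product; for u > 0 the bound a + b <= 2 c is
     used. *)
  have [h|h] := leP (u w) 0; first by rewrite mulr0 mulr_ge0_le0.
  rewrite ler_pM2r// mulr_natl mulr2n lerD//.
  - exact: le_trans (ler_norm _) (ac w).
  - exact: le_trans (ler_norm _) (bc w).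
rewrite RintegralZl//; last exact: iA.
have c0 : 0 <= c by apply: le_trans (ac point).
rewrite ler_wpM2l ?mulr_ge0//.
rewrite -[A]setTI -Rintegral_indicM; apply: le_Rintegral => //.
  apply: (@integrable_EFinMb _ _ _ _ _ _ _ 1) => //.
  by move=> w _; exact: indic_norm_le1.
by move=> w _; rewrite ler_piMl ?le_max ?lexx ?orbT//.
Qed.

End linearised_drift.

Lemma le_Rintegral_norm dd (Omega : measurableType dd) (R : realType)
    (mu : measure Omega R) (X : Omega -> R) (M : R) :
  mu.-integrable setT (EFin \o X) -> (\int[mu]_w `|X w|%:E <= M%:E)%E ->
  \int[mu]_w `|X w| <= M.
Proof.
move=> /(@integrable_norm _ _ _ mu) iX; rewrite -lee_fin /Rintegral fineK//.
exact: integrable_fin_num iX.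
Qed.

Theorem proposition2p12
  (dd : measure_display) (Omega : measurableType dd) (R : realType)
  (P : probability Omega R) (T : R) (T_gt0 : 0 < T)
  (F G : R -> set (set Omega))
  (usualF : usual_conditions P T F) (subG : subfiltration T G F)
  (d : nat) (d_gt0 : (0 < d)%N)
  (B : R -> Omega -> 'rV[R]_d) (BM : brownian_motion P T F B)
  (f1 : driver Omega R d) (f2 : R -> Omega -> R -> R -> R)
  (f1_std : standard_lipschitz_driver P T F f1)
  (f2_std : standard_lipschitz_driver P T F
              (fun t w y (_ : 'rV[R]_d) y' (_ : 'rV[R]_d) => f2 t w y y'))
  (xi1 xi2 : Omega -> R) (xi1_L2 : L2 P (F T) xi1) (xi2_L2 : L2 P (F T) xi2)
  (K1 K2 : R -> Omega -> R) (K1_S2 : S2 P T F K1) (K2_S2 : S2 P T F K2)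
  (Y1 Y2 : R -> Omega -> R) (Z1 Z2 : R -> Omega -> 'rV[R]_d)
  (EY1 EY2 : R -> Omega -> R) (EZ1 EZ2 : R -> Omega -> 'rV[R]_d)
  (sol1 : bsde_solution P T F G B f1 xi1 K1 Y1 Z1 EY1 EZ1)
  (sol2 : bsde_solution P T F G B
            (fun t w y (_ : 'rV[R]_d) y' (_ : 'rV[R]_d) => f2 t w y y')
            xi2 K2 Y2 Z2 EY2 EZ2)
  (hyp1 : condexp_le P (G T) xi1 (G T) xi2)
  (hyp2 :
     (forall s t, 0 <= s -> s <= t -> t <= T ->
        condexp_le P (G s) (fun w => K2 s w - K1 s w)
                     (G t) (fun w => K2 t w - K1 t w)) \/
     {ae P, forall w, forall s t, 0 <= s -> s <= t -> t <= T ->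
        K2 s w - K1 s w <= K2 t w - K1 t w})
  (hyp3 : forall t, t \in `[0, T] ->
     (forall j, P.-integrable [set: Omega] (fun w => (Z1 t w 0 j)%:E)) ->
     condexp_le P
       (G t) (fun w => f1 t w (Y1 t w) (Z1 t w) (EY1 t w) (EZ1 t w))
       (G t) (fun w => f2 t w (Y1 t w) (EY1 t w)))
  (a b : R -> Omega -> R)
  (a_def : forall t w, a t w =
     (f2 t w (Y1 t w) (EY1 t w) - f2 t w (Y2 t w) (EY1 t w))
       / (Y1 t w - Y2 t w) * (Y1 t w != Y2 t w)%:R)
  (b_def : forall t w, b t w =
     (f2 t w (Y2 t w) (EY1 t w) - f2 t w (Y2 t w) (EY2 t w))
       / (EY1 t w - EY2 t w) * (EY1 t w != EY2 t w)%:R)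
  (hyp4_adapted : adapted T G a)
  (hyp4_ge0 : forall t, t \in `[0, T] ->
     {ae P, forall w, 0 <= a t w + b t w}) :
  forall t, t \in `[0, T] -> {ae P, forall w, EY1 t w <= EY2 t w}.
Proof.
have [filF _ _] := usualF; have [filG GF] := subG.
have TT : T \in `[0, T] by rewrite in_itv/= lexx ltW.
have [Y1_S2 Z1_H2 [pEY1 cEY1] _ _] := sol1.
have [Y2_S2 _ [pEY2 cEY2] _ _] := sol2.
have [M1 Y1M] := S2_bounded T_gt0 filF Y1_S2.
have [M2 Y2M] := S2_bounded T_gt0 filF Y2_S2.
have [N1 K1N] := S2_bounded T_gt0 filF K1_S2.
have [N2 K2N] := S2_bounded T_gt0 filF K2_S2.
have iY1 := S2_dtdP T_gt0 filF Y1_S2.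
have iEY1 : dtdP_integrable P T EY1.
  exact: (condexp_process_dtdP T_gt0 subG iY1 (conj pEY1 cEY1)).
have iEY2 : dtdP_integrable P T EY2.
  exact: (condexp_process_dtdP T_gt0 subG (S2_dtdP T_gt0 filF Y2_S2) (conj pEY2 cEY2)).
have c1 s : s \in `[0, T] -> is_condexp P (G s) (Y1 s) (EY1 s).
  by move=> sT; apply: cEY1 => //; exact: (Y1M s sT).1.
have c2 s : s \in `[0, T] -> is_condexp P (G s) (Y2 s) (EY2 s).
  by move=> sT; apply: cEY2 => //; exact: (Y2M s sT).1.
pose y s w := Y1 s w - Y2 s w.
pose u s w := EY1 s w - EY2 s w.
have cyu s : s \in `[0, T] -> is_condexp P (G s) (y s) (u s).
  by move=> sT; apply: condexpB; [exact: (filtration_measurable filG sT)|exact: c1|exact: c2].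
pose phi1 s w := f1 s w (Y1 s w) (Z1 s w) (EY1 s w) (EZ1 s w).
pose phi2 s w := f2 s w (Y2 s w) (EY2 s w).
(* The driver [f2] along the first solution: hypothesis (3) compares [phi1] with it, and
   [psi - phi2] splits into a change of the state ([a]) and a change of its conditional expectation
   ([b]). *)
pose psi s w := f2 s w (Y1 s w) (EY1 s w).
have i1 : dtdP_integrable P T phi1.
  exact: (bsde_driver_dtdP T_gt0 filF subG f1_std sol1).
have i2 : dtdP_integrable P T phi2.
  exact: (bsde_driver_dtdP T_gt0 filF subG f2_std sol2).
have iZ1 j := H2_coord_dtdP T_gt0 filF j Z1_H2.
have ipsi : dtdP_integrable P T psi.
  (* The driver built from [f2] ignores its vector arguments; [Z1] merely fills both places. *)
  exact: (driver_dtdP T_gt0 filF f2_std iY1 iZ1 iEY1 iZ1).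
have [_ [c c0 lip] _] := f2_std.
have lip2 s w y1 y1' y2 y2' : s \in `[0, T] ->
    `|f2 s w y1 y1' - f2 s w y2 y2'| <= c * (`|y1 - y2| + `|y1' - y2'|).
  move=> sT; have := lip s w y1 0 y1' 0 y2 0 y2' 0 sT.
  by rewrite subrr enorm0 !addr0.
have aP s w : s \in `[0, T] ->
    a s w * y s w = psi s w - f2 s w (Y2 s w) (EY1 s w) /\ `|a s w| <= c.
  move=> sT; rewrite a_def; apply: difference_quotientP; first exact: ltW.
  by apply: le_trans (lip2 _ _ _ _ _ _ sT) _; rewrite subrr normr0 addr0.
have bP s w : s \in `[0, T] ->
    b s w * u s w = f2 s w (Y2 s w) (EY1 s w) - phi2 s w /\ `|b s w| <= c.
  move=> sT; rewrite b_def; apply: difference_quotientP; first exact: ltW.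
  by apply: le_trans (lip2 _ _ _ _ _ _ sT) _; rewrite subrr normr0 add0r.
have iu : dtdP_integrable P T u by exact: dtdP_integrableB.
pose up s w := Num.max (u s w) 0.
have iup : dtdP_integrable P T up.
  apply: dtdP_integrable_le (dtdP_integrable_norm iu) _.
    by apply: measurable_maxr => //; exact: (dtdP_jointly_measurable iu).
  move=> s w _; rewrite /up; case: (leP (u s w) 0) => // _.
  by rewrite normr0.
(* Hypothesis (3) and the integrability of the drivers are only available at
   almost every time. *)
have drift : {ae lebesgue_measure, forall s, s \in `[0, T] -> forall A, G s A ->
    \int[P]_(w in A) phi1 s w <= \int[P]_(w in A) phi2 s w + 2 * c * \int[P]_w up s w}.
  have aef := @ae_filter_ringOfSetsType _ _ R (@lebesgue_measure R).
  have gZ := @filter_forall _ _ _ _ aef (fun j => dtdP_ae_integrable (iZ1 j)).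
  have g := @filterI _ _ aef _ _ gZ (@filterI _ _ aef _ _ (dtdP_ae_integrable i1)
    (@filterI _ _ aef _ _ (dtdP_ae_integrable i2) (dtdP_ae_integrable ipsi))).
  apply: (@filterS _ _ aef _ _ _ g) => s [gsZ [gs1 [gs2 gspsi]]] sT A GA.
  have sG := filtration_sigma filG sT; have mG := filtration_measurable filG sT.
  have mA := mG _ GA.
  have step1 : \int[P]_(w in A) phi1 s w <= \int[P]_(w in A) psi s w.
    apply: (condexp_le_Rintegral sG mG sG mG (gs1 sT) (gspsi sT)) => //.
    by apply: hyp3 => // j; exact: (gsZ j sT).
  have iD := integrable_EFinB measurableT (gspsi sT) (gs2 sT).
  have step2 := linearised_drift_le sG mG (y := y s) (u := u s) (a := a s) (b := b s)
    (D := fun w => psi s w - phi2 s w) (c := c) (A := A).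
  have {}step2 : \int[P]_(w in A) (psi s w - phi2 s w) <= 2 * c * \int[P]_w up s w.
    apply: step2 => //.
    - by have [] := cyu s sT.
    - exact: cyu.
    - exact: hyp4_adapted.
    - by move=> w; exact: (aP s w sT).2.
    - by move=> w; exact: (bP s w sT).2.
    - exact: hyp4_ge0.
    - by move=> w; rewrite (aP s w sT).1 (bP s w sT).1; ring.
  rewrite RintegralB// in step2; first by lra.
  - exact: integrableS (gspsi sT).
  - exact: integrableS (gs2 sT).
have terminal A : G T A -> \int[P]_(w in A) Y1 T w <= \int[P]_(w in A) Y2 T w.
  move=> GA; have mA := filtration_measurable filG TT GA.
  have mG := filtration_measurable filG TT.
  have iL2 xi : L2 P (F T) xi -> P.-integrable setT (EFin \o xi).
    move=> [mxi fxi]; apply: (sqr_integrable _ fxi).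
    exact: (filtration_sub_measurable filF TT mxi).
  (* Since Y_T = xi almost surely, [EY1 T] and [EY2 T] are versions of the conditional expectations
     compared in hypothesis (1). *)
  have cxi1 := condexp_ae_eq mG (iL2 _ xi1_L2) (bsde_terminal T_gt0 sol1) (c1 T TT).
  have cxi2 := condexp_ae_eq mG (iL2 _ xi2_L2) (bsde_terminal T_gt0 sol2) (c2 T TT).
  rewrite -(condexp_Rintegral (c1 T TT) GA) -(condexp_Rintegral (c2 T TT) GA).
  have [_ iV1 _ _] := cxi1; have [_ iV2 _ _] := cxi2.
  apply: ae_le_Rintegral => //; [exact: integrableS iV1|exact: integrableS iV2|].
  by apply: filterS (hyp1 _ _ cxi1 cxi2) => w.
have Kle t A : t \in `[0, T] -> G t A ->
    \int[P]_(w in A) (K1 T w - K1 t w) <= \int[P]_(w in A) (K2 T w - K2 t w).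
  move=> tT GA; have mA := filtration_measurable filG tT GA.
  have [t0 tleT] : 0 <= t /\ t <= T by move: tT; rewrite in_itv/= => /andP[].
  have iK1 s : s \in `[0, T] -> P.-integrable setT (EFin \o K1 s).
    by move=> sT; exact: (K1N s sT).1.
  have iK2 s : s \in `[0, T] -> P.-integrable setT (EFin \o K2 s).
    by move=> sT; exact: (K2N s sT).1.
  have iK s : s \in `[0, T] -> P.-integrable setT (EFin \o (fun w => K2 s w - K1 s w)).
    by move=> sT; apply: integrable_EFinB => //; [exact: iK2|exact: iK1].
  have iA (X : Omega -> R) :
      P.-integrable setT (EFin \o X) -> P.-integrable A (EFin \o X).
    exact: integrableS.
  suff : \int[P]_(w in A) (K2 t w - K1 t w) <= \int[P]_(w in A) (K2 T w - K1 T w).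
    have iKA1 s := fun sT => iA _ (iK1 s sT); have iKA2 s := fun sT => iA _ (iK2 s sT).
    by rewrite !RintegralB//; [lra|auto..].
  (* In the conditional form the values at [t] and [T] are averaged over different sigma-algebras,
     but [A] lies in both; the pathwise form is integrated directly. *)
  case: hyp2 => [h|h].
    have st := filtration_sigma filG tT; have mt := filtration_measurable filG tT.
    have sT := filtration_sigma filG TT; have mT := filtration_measurable filG TT.
    apply: (condexp_le_Rintegral st mt sT mT (iK t tT) (iK T TT)) => //.
      exact: h.
    exact: (filG.2 t T).
  apply: ae_le_Rintegral => //; [by apply: iA; exact: iK..|].
  by apply: filterS h => w h _; exact: h.
have meas_u t : t \in `[0, T] -> G t [set w | 0 < u t w].
  move=> tT; have [_ _ mu _] := cyu t tT.
  have := (sub_measurableP (filtration_sigma filG tT) _).1 mu _ (measurable_itv `]0, +oo[).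
  by congr (G t); apply/seteqP; split => w /=; rewrite in_itv/= andbT.
pose phi s := \int[P]_w up s w.
have iups s : s \in `[0, T] -> P.-integrable setT (EFin \o up s).
  move=> sT; have [_ ius _ _] := cyu s sT.
  have mus := integrable_EFin_measurable ius.
  apply: (le_integrable measurableT _ _ ius).
    by apply/measurable_EFinP; exact: measurable_maxr.
  move=> w _; rewrite /= lee_fin /up; case: (leP (u s w) 0) => // _.
  by rewrite normr0.
have phi_ineq t : t \in `[0, T] ->
    phi t <= 2 * c * \int[lebesgue_measure]_(s in `[t, T]) phi s.
  move=> tT; have GA := meas_u t tT; set A := [set w | _] in GA.
  have mA := filtration_measurable filG tT GA.
  have [t0 tleT] : 0 <= t /\ t <= T by move: tT; rewrite in_itv/= => /andP[].
  have GTA : G T A by apply: (filG.2 t T).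
  have FA : F t A by exact: GF.
  (* [A] is the set where [u t] is positive, so restricting to it takes the positive part. *)
  have -> : phi t = \int[P]_(w in A) u t w.
    rewrite /phi -[A]setTI -Rintegral_indicM; apply: eq_Rintegral => w _.
    rewrite /up indicE; case: (leP (u t w) 0) => h.
      by rewrite memNset ?mul0r// /A/= ltNge h.
    by rewrite mem_set ?mul1r.
  rewrite (condexp_Rintegral (cyu t tT) GA) /y RintegralB//; last 2 first.
  - by apply: integrableS (Y1M t tT).1.
  - by apply: integrableS (Y2M t tT).1.
  rewrite (bsde_Rintegral T_gt0 filF subG BM f1_std K1_S2 sol1 tT FA).
  rewrite (bsde_Rintegral T_gt0 filF subG BM f2_std K2_S2 sol2 tT FA).
  have mI : measurable (`[t, T]%classic : set (measurableTypeR R)).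
    exact: measurable_itv.
  have iphi1 := dtdP_integrable_time i1 tT mA.
  have iphi2 := dtdP_integrable_time i2 tT mA.
  have iphi := dtdP_integrable_time iup tT measurableT.
  have driftI : \int[lebesgue_measure]_(s in `[t, T]) (\int[P]_(w in A) phi1 s w) <=
      \int[lebesgue_measure]_(s in `[t, T]) (\int[P]_(w in A) phi2 s w) +
      2 * c * \int[lebesgue_measure]_(s in `[t, T]) phi s.
    rewrite -RintegralZl// -RintegralD//; last exact: integrable_EFinZ.
    apply: ae_le_Rintegral => //.
      by apply: integrable_EFinD => //; exact: integrable_EFinZ.
    apply: (@filterS _ _ (@ae_filter_ringOfSetsType _ _ R lebesgue_measure) _ _ _ drift).
    move=> s h; rewrite /= in_itv/= => /andP[ts sT].
    apply: h; first by rewrite in_itv/= sT (le_trans t0).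
    exact: (filG.2 t s).
  rewrite lerBlDr; apply: le_trans (lerD (lerD (terminal A GTA) driftI) (Kle t A tT GA)) _.
  by rewrite le_eqVlt; apply/orP; left; apply/eqP; ring.
(* The a priori bound that starts the Gronwall iteration: conditional expectation contracts L^1, so
   the uniform bounds on [Y1] and [Y2] carry over. *)
have phi_le t : t \in `[0, T] -> phi t <= M1 + M2.
  move=> tT.
  have sG := filtration_sigma filG tT; have mG := filtration_measurable filG tT.
  have [_ iE1 _ _] := c1 t tT; have [_ iE2 _ _] := c2 t tT.
  have b1 := le_Rintegral_norm iE1
    (le_trans (condexp_norm_le sG mG (c1 t tT)) (Y1M t tT).2).
  have b2 := le_Rintegral_norm iE2
    (le_trans (condexp_norm_le sG mG (c2 t tT)) (Y2M t tT).2).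
  apply: (@le_trans _ _ (\int[P]_w (`|EY1 t w| + `|EY2 t w|))).
    apply: le_Rintegral => //; first exact: iups.
      by apply: integrable_EFinD => //; exact: integrable_norm.
    move=> w _; rewrite /up /u ge_max addr_ge0// andbT.
    exact: le_trans (ler_norm _) (ler_normB _ _).
  by rewrite RintegralD//; [exact: lerD|exact: integrable_norm..].
have phi_int : lebesgue_measure.-integrable `[0, T] (EFin \o phi).
  by apply: (dtdP_integrable_time iup) => //; rewrite in_itv/= lexx ltW.
move=> t tT.
have c2_gt0 : 0 < 2 * c by rewrite mulr_gt0.
have phi0 := backward_gronwall c2_gt0 phi_le phi_int phi_ineq tT.
have up0 w : 0 <= up t w by rewrite /up le_max lexx orbT.
(* A nonnegative variable of zero expectation vanishes almost surely, that is, u_t <= 0. *)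
have intup0 : (\int[P]_w `|(up t w)%:E| = 0)%E.
  have fin := integrable_fin_num measurableT (iups t tT).
  under eq_integral do rewrite gee0_abs ?lee_fin//.
  rewrite -(fineK fin); congr EFin; apply/le_anti; rewrite phi0/=.
  by apply: Rintegral_ge0.
have := (ae_eq_integral_abs P measurableT (measurable_int P (iups t tT))).1 intup0.
apply: filterS => w /(_ I) /= [h].
by rewrite -subr_le0 -[leRHS]h /up /u le_max lexx.
Qed.
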